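(* Let $X=(X_t)_{t\ge 0}$ be an arbitrary real-valued Lévy process with Lévy measure $\Pi$, and let $\eta_1,\eta_2>0$ be fixed with $\Delta:=\Pi(I^c)>0$, where $I=[-\eta_1,\eta_2]$. Let $\tau_n$, $\hat S$, $M_n$, $I_n$, $\tilde m_0$, $\tilde i_0$ be as defined in the context. Then $$M_n = S_n^{(+)}+\tilde m_0,\qquad I_n=S_n^{(-)}+\tilde i_0,\qquad n\ge 0,$$ where both of the processes $S^{(+)}=(S_n^{(+)},n\ge 0)$ and $S^{(-)}=(S_n^{(-)},n\ge 0)$ (that is, the processes defined by $S_n^{(+)}:=M_n-\tilde m_0$ and $S_n^{(-)}:=I_n-\tilde i_0$) are random walks with the same distribution as $\hat S=(\hat S_n,n\ge 0)$. Moreover, $S^{(+)}$ and $\tilde m_0$ are independent, and $S^{(-)}$ and $\tilde i_0$ are independent.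
   Context: $X$ is a Lévy process on $\mathbb{R}$ with $X_0=0$ and càdlàg paths. Put $\tau_0=0$ and, for $n\ge1$, let $\tau_n$ be the time at which the $n$th jump of $X$ whose value lies in $I^c=\mathbb{R}\setminus[-\eta_1,\eta_2]$ occurs, and let $J_n$ be the value of that jump. (So $(\tau_n)_{n\ge1}$ are the points of a Poisson process of rate $\Delta$, independent of the i.i.d. sequence $(J_n)_{n\ge1}$, which has common law $\Delta^{-1}\mathbf 1_{I^c}(x)\,\Pi(dx)$.) Put $e_n=\tau_n-\tau_{n-1}$ for $n\ge 1$. Define $\hat S_n=X(\tau_n)$, $n\ge 0$; this is a random walk started at $0$. $\tilde X$ is the process $X$ with the jumps $J_1,J_2,\dots$ removed: $\tilde X_t=X_t-\sum_{n\ge 1:\,\tau_n\le t}J_n$. It is a Lévy process independent of $\{(J_n,\tau_n),n\ge1\}$. For $n\ge 0$, $$M_n=\sup_{\tau_n\le t<\tau_{n+1}}X_t,\qquad I_n=\inf_{\tau_n\le t<\tau_{n+1}}X_t,$$ and $$\tilde m_0=\sup_{0\le s<e_1}\tilde X_s,\qquad \tilde i_0=\inf_{0\le s<e_1}\tilde X_s .$$ *)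

(* Defs.v *)
From HB Require Import structures.
From mathcomp Require Import all_boot all_order all_algebra.
From mathcomp Require Import finmap.
From mathcomp Require Import all_classical all_reals all_analysis.

Set Implicit Arguments.
Unset Strict Implicit.
Unset Printing Implicit Defensive.

Import Order.TTheory GRing.Theory Num.Theory.
Import numFieldNormedType.Exports.

Local Open Scope classical_set_scope.
Local Open Scope ring_scope.

Section Independence.
Context (R : realType) (d : measure_display) (T : measurableType d)
  (P : probability T R).

Definition mutually_independent (I : choiceType) (Y : I -> T -> R) : Prop :=
  forall (F : {fset I}) (B : I -> set R), (forall i, measurable (B i)) ->
    P (\bigcap_(i in [set` F]) (Y i @^-1` B i)) =
    (\prod_(i <- F) P (Y i @^-1` B i))%E.

Definition identically_distributed (Y Z : T -> R) : Prop :=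
  forall B : set R, measurable B -> P (Y @^-1` B) = P (Z @^-1` B).

End Independence.

Section LevyProcess.
Context (R : realType) (d : measure_display) (T : measurableType d)
  (P : probability T R).

(* Processes are indexed by all of [R]; only times t >= 0 are ever used. *)
Definition cadlag (x : R -> R) : Prop :=
  (forall t, 0 <= t -> x s @[s --> t^'+] --> x t) /\
  (forall t, 0 < t -> cvg (x s @[s --> t^'-])).

Definition levy_process (X : R -> T -> R) : Prop :=
  [/\ forall t, 0 <= t -> measurable_fun setT (X t),
      forall w, X 0 w = 0,
      forall w, cadlag (X ^~ w),
      forall t : nat -> R, 0 <= t 0%N -> (forall i, t i <= t i.+1) ->
        mutually_independent P (fun i w => X (t i.+1) w - X (t i) w) &
      forall s t, 0 <= s -> 0 <= t ->
        identically_distributed P (fun w => X (s + t) w - X s w) (X t)].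

Definition jump (X : R -> T -> R) (t : R) (w : T) : R :=
  X t w - lim (X s w @[s --> t^'-]).

Definition unit_jump_times (X : R -> T -> R) (A : set R) (w : T) : set R :=
  [set t | [/\ 0 < t, t <= 1, jump X t w <> 0 & A (jump X t w)]].

(* Pi A is the expected number of nonzero jumps with value in A per unit
   time. *)
Definition has_levy_measure (X : R -> T -> R)
    (Pi : {measure set R -> \bar R}) : Prop :=
  forall A : set R, measurable A ->
    Pi A = (\int[P]_w counting (unit_jump_times X A w))%E.

End LevyProcess.

Section Decomposition.
Context (R : realType) (d : measure_display) (T : measurableType d).
Context (X : R -> T -> R) (eta1 eta2 : R).

Definition small_jumps : set R := [set x | - eta1 <= x <= eta2].

(* The jumps of a cadlag path with value outside [-eta1, eta2] occur at a
   locally finite set of times, so the infimum is attained when it is finite.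
   It is +oo when there is no further such jump, which has probability 0 if
   the Levy measure charges the complement of [-eta1, eta2]. *)
Fixpoint tau (n : nat) (w : T) : \bar R :=
  if n is m.+1 then
    ereal_inf [set t%:E | t in [set t : R |
      (tau m w < t%:E)%E /\ (~` small_jumps) (jump X t w)]]
  else 0%E.

(* For n >= 1, and on the event that tau n is finite. *)
Definition J_ (n : nat) (w : T) : R := jump X (fine (tau n w)) w.

(* For n >= 1. *)
Definition e_ (n : nat) (w : T) : \bar R := (tau n w - tau n.-1 w)%E.

Definition Shat (n : nat) (w : T) : R := X (fine (tau n w)) w.

Definition Xtilde (t : R) (w : T) : R :=
  X t w -
  \sum_(n \in [set n : nat | (1 <= n)%N /\ (tau n w <= t%:E)%E]) J_ n w.

(* The real-valued [sup] and [inf] below are taken over nonempty bounded sets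
   as soon as the right endpoint of the time interval is finite. *)
Definition M_ (n : nat) (w : T) : R :=
  sup [set X t w | t in [set t : R | (tau n w <= t%:E < tau n.+1 w)%E]].

Definition I_ (n : nat) (w : T) : R :=
  inf [set X t w | t in [set t : R | (tau n w <= t%:E < tau n.+1 w)%E]].

Definition m0 (w : T) : R :=
  sup [set Xtilde s w | s in [set s : R | (0 <= s%:E < e_ 1 w)%E]].

Definition i0 (w : T) : R :=
  inf [set Xtilde s w | s in [set s : R | (0 <= s%:E < e_ 1 w)%E]].

Definition Splus (n : nat) (w : T) : R := M_ n w - m0 w.

Definition Sminus (n : nat) (w : T) : R := I_ n w - i0 w.

End Decomposition.

Section RandomWalk.
Context (R : realType) (d : measure_display) (T : measurableType d)
  (P : probability T R).

Definition random_sequence (S : nat -> T -> R) : Prop :=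
  forall n, measurable_fun setT (S n).

Definition random_walk (S : nat -> T -> R) : Prop :=
  [/\ random_sequence S,
      forall w, S 0%N w = 0,
      mutually_independent P (fun n w => S n.+1 w - S n w) &
      forall n, identically_distributed P
        (fun w => S n.+1 w - S n w) (fun w => S 1%N w - S 0%N w)].

(* The product sigma-algebra on the space of real sequences. *)
Definition seq_measurable : set (set (nat -> R)) :=
  <<s \bigcup_n preimage_set_system setT (fun x : nat -> R => x n)
        (measurable : set (set R)) >>.

Definition same_distribution (S S' : nat -> T -> R) : Prop :=
  [/\ random_sequence S, random_sequence S' &
      forall C, seq_measurable C ->
        P [set w | C (S ^~ w)] = P [set w | C (S' ^~ w)]].

Definition independent_of (S : nat -> T -> R) (Y : T -> R) : Prop :=
  [/\ random_sequence S, measurable_fun setT Y &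
      forall (C : set (nat -> R)) (B : set R),
        seq_measurable C -> measurable B ->
        P ([set w | C (S ^~ w)] `&` Y @^-1` B) =
        (P [set w | C (S ^~ w)] * P (Y @^-1` B))%E].

End RandomWalk.

(* Main.v *)
Require Import Defs.
From HB Require Import structures.
From mathcomp Require Import all_boot all_order all_algebra.
From mathcomp Require Import finmap zify ring lra.
From mathcomp Require Import all_classical all_reals all_analysis.
From mathcomp Require Import measurable_realfun.

(** Let [t_0 = 0] and let [t_1 < t_2 < ...] be the times of the jumps with value
    outside [[-eta1, eta2]]. On [[t_k, t_k+1)] the path goes from [X (t_k)] up
    to its supremum [M_k] and then down to [X (t_k+1)]. Call [a_k = M_k - X
    (t_k)] the rise and [b_k = X (t_k+1) - M_k] the fall of the [k]-th block.
    Everything follows from one fact: [a_0, b_0, a_1, b_1, ...] are independent,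
    all rises have the same law, and so have all falls ([path_rise_fall_indep],
    [path_rise_fall_alternating]). Indeed [X (t_n)] is the sum of [a_k + b_k]
    over [k < n], while [M_n] is [a_0] plus the sum of [b_k + a_k+1] over [k <
    n], and [a_0 = M_0] is [m0] because no large jump occurs before [t_1]
    ([m0_M0]). Hence [S+] and [Shat] are walks whose steps are each the sum of
    one rise and one fall, so that they have the same law, and the steps of [S+]
    do not involve [a_0] ([alternating_random_walk],
    [alternating_same_distribution], [alternating_independent_of]).

    The independence of rises and falls is the Wiener-Hopf factorisation at a
    geometric time. For a random walk with i.i.d. steps, some values of which
    are called marks, a block ends with its first marked step. Cut the block at
    the first time [g] at which its maximum is attained, and let [l] steps
    separate it from the marked step. That the block has this shape, rises by an
    element of [B] and falls by an element of [C] is the conjunction of a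
    condition on the first [g] steps (no mark, and the endpoint, in [B], is a
    strict new maximum) and of a condition on the next [l + 1] steps (the sums
    before the mark stay nonpositive, and the sum including the mark is in [C]).
    The probability is therefore a product, and summing over [g] and [l] gives
    [u(B) v(C)] ([blocks_factor], [blocks_indep], [rise_fall_indep]).

    The passage to [X] is a limit along dyadic grids. A grid step is a mark when
    it lies outside the window [[-eta1, eta2]] widened by [1 / (p + 1)]. Fix a
    path with large jumps at arbitrarily late times. Once the widening is below
    the distance from the window to each of the first few large jumps, and the
    mesh is then fine enough, the marked steps up to these jumps are exactly the
    steps that contain one of them, and the rises and falls on the grid converge
    to those of the path ([rise_fall_cvg]). Independence and equality of laws
    survive a limit in probability, as is seen on distribution functions
    ([limit_indep], [limit_law]). Almost every path has large jumps at
    arbitrarily late times, because with positive probability there is one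
    before time 1, and different unit intervals are independent at the level of
    the grid ([pr_no_jump_after]).

    The statements on infima are those on suprema for the process [- X], with
    [eta1] and [eta2] exchanged. *)

Set Implicit Arguments.
Unset Strict Implicit.
Unset Printing Implicit Defensive.

Import Order.TTheory GRing.Theory Num.Theory.
Import numFieldNormedType.Exports.

Local Open Scope classical_set_scope.
Local Open Scope ring_scope.

(** * Probabilities as real numbers *)

Section Prob.
Context (R : realType) (d : measure_display) (T : measurableType d)
  (P : probability T R).

Definition pr (A : set T) : R := fine (P A).

Lemma prE A : measurable A -> P A = (pr A)%:E.
Proof. by move=> mA; rewrite /pr fineK// fin_num_measure. Qed.

Lemma pr_ge0 A : 0 <= pr A.
Proof. by rewrite /pr fine_ge0. Qed.

Lemma pr_le1 A : measurable A -> pr A <= 1.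
Proof. by move=> mA; rewrite -lee_fin -prE// probability_le1. Qed.

Lemma pr_setT : pr setT = 1.
Proof. by rewrite /pr probability_setT. Qed.

Lemma pr_set0 : pr set0 = 0.
Proof. by rewrite /pr measure0. Qed.

Lemma le_pr A B : measurable A -> measurable B -> A `<=` B -> pr A <= pr B.
Proof.
by move=> mA mB AB; rewrite -lee_fin -!prE// le_measure// inE.
Qed.

Lemma prC A : measurable A -> pr (~` A) = 1 - pr A.
Proof.
by move=> mA; rewrite {1}/pr probability_setC// prE.
Qed.

Lemma prU_le A B : measurable A -> measurable B -> pr (A `|` B) <= pr A + pr B.
Proof.
move=> mA mB; rewrite -lee_fin EFinD -!prE//; last exact: measurableU.
exact: measureU2.
Qed.

Lemma pr_cvg_up (F : (set T)^nat) : (forall n, measurable (F n)) ->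
  nondecreasing_seq F -> pr (F n) @[n --> \oo] --> pr (\bigcup_n F n).
Proof.
move=> mF ndF.
have mU : measurable (\bigcup_n F n) by exact: bigcupT_measurable.
have : P (F n) @[n --> \oo] --> P (\bigcup_n F n).
  exact: (nondecreasing_cvg_mu (mu := P) mF mU ndF).
by rewrite (prE mU) => /fine_cvg.
Qed.

Lemma pr_cvg_down (F : (set T)^nat) : (forall n, measurable (F n)) ->
  nonincreasing_seq F -> pr (F n) @[n --> \oo] --> pr (\bigcap_n F n).
Proof.
move=> mF ndF.
have mU : measurable (\bigcap_n F n) by exact: bigcapT_measurable.
have : P (F n) @[n --> \oo] --> P (\bigcap_n F n).
  apply: (nonincreasing_cvg_mu (mu := P) _ mF mU ndF).
  by rewrite ltey_eq fin_num_measure.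
by rewrite (prE mU) => /fine_cvg.
Qed.

(** Measure uniqueness for [B |-> pr (E `&` f @^-1` B)] against a multiple
    of the law of [h].  With [h = f] it extends an independence statement from
    a pi-system, and with [E] full and [c = 1] an equality of laws. *)
Lemma pr_scale_unique d' (S : measurableType d') (G : set (set S))
    (g : (set S)^nat) (f h : T -> S) (E : set T) (c : R) :
  measurable = <<s G >> -> setI_closed G -> (forall i, G (g i)) ->
  \bigcup_k g k = setT -> measurable_fun setT f -> measurable_fun setT h ->
  measurable E -> 0 <= c ->
  (forall B, G B -> pr (E `&` f @^-1` B) = c * pr (h @^-1` B)) ->
  forall B, measurable B -> pr (E `&` f @^-1` B) = c * pr (h @^-1` B).
Proof.
move=> mG GI Gg cov mf mh mE c0 eqG B mB.
have mfB C : measurable C -> measurable (f @^-1` C).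
  by move=> mC; rewrite -[X in measurable X]setTI; exact: mf.
have mhB C : measurable C -> measurable (h @^-1` C).
  by move=> mC; rewrite -[X in measurable X]setTI; exact: mh.
pose m1 := pushforward (mrestr P mE) f.
pose m2 := mscale (NngNum c0) (pushforward P h).
have m1E C : measurable C -> m1 C = (pr (E `&` f @^-1` C))%:E.
  move=> mC; rewrite /m1 /pushforward /mrestr setIC prE//.
  by apply: measurableI => //; exact: mfB.
have m2E C : measurable C -> m2 mh C = (c * pr (h @^-1` C))%:E.
  by move=> mC; rewrite EFinM -(prE (mhB _ mC)).
suff : m1 B = m2 mh B by rewrite m1E// m2E// => -[].
apply: (measure_unique G g) => //.
- move=> C GC; have mC : measurable C by rewrite mG; exact: sub_sigma_algebra.
  by have : m1 C = m2 mh C by rewrite m1E// m2E// eqG.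
- move=> k; have mC : measurable (g k) by rewrite mG; exact: sub_sigma_algebra.
  by have : (m1 (g k) < +oo)%E by rewrite m1E// ltry.
Qed.

(** The intersections of tails increase to the limit inferior. *)
Lemma pr_liminf (A : (set T)^nat) (c : R) : (forall n, measurable (A n)) ->
  c < pr (\bigcup_k \bigcap_(j in [set j | (k <= j)%N]) A j) ->
  exists k, c < pr (\bigcap_(j in [set j | (k <= j)%N]) A j).
Proof.
move=> mA cA.
pose F k := \bigcap_(j in [set j | (k <= j)%N]) A j.
have mF k : measurable (F k).
  by apply: bigcap_measurable => //; exists k => /=.
have ndF : nondecreasing_seq F.
  move=> k l kl; apply/subsetPset => w Fw j /= lj; apply: Fw => /=.
  exact: leq_trans lj.
have /cvgr_gt /(_ c cA) [N _ /(_ N (leqnn N)) NP] := pr_cvg_up mF ndF.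
by exists N.
Qed.

Lemma pr_liminf_ex (A : (set T)^nat) (c : R) : (forall n, measurable (A n)) ->
  c < pr (\bigcup_k \bigcap_(j in [set j | (k <= j)%N]) A j) ->
  exists k, forall j, (k <= j)%N -> c < pr (A j).
Proof.
move=> mA /(pr_liminf mA)[k ck]; exists k => j kj.
apply: (lt_le_trans ck); apply: le_pr => //.
  by apply: bigcap_measurable => //; exists k => /=.
by move=> w /(_ j kj).
Qed.

Lemma pr_bigcup0 (F : (set T)^nat) : (forall i, measurable (F i)) ->
  (forall i, pr (F i) = 0) -> pr (\bigcup_i F i) = 0.
Proof.
move=> mF F0; have mU : measurable (\bigcup_i F i) by exact: bigcupT_measurable.
apply: EFin_inj; rewrite -prE//; apply/(negligibleP P mU).
apply: negligible_bigcup => i; apply/(negligibleP P (mF i)).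
by have := prE (mF i); rewrite F0.
Qed.

Lemma pr_bigcup_gt0 (F : (set T)^nat) : (forall i, measurable (F i)) ->
  0 < pr (\bigcup_i F i) -> exists i, 0 < pr (F i).
Proof.
move=> mF; apply: contraPP => /forallNP h.
rewrite pr_bigcup0 ?ltxx// => i; apply/eqP.
by rewrite eq_le pr_ge0 andbT leNgt; apply/negP.
Qed.

Lemma measurable_liminf (F : (set T)^nat) : (forall i, measurable (F i)) ->
  measurable (\bigcup_k \bigcap_(j in [set j | (k <= j)%N]) F j).
Proof.
move=> mF; apply: bigcupT_measurable => k.
by apply: bigcap_measurable => //; exists k => /=.
Qed.

(** The integral is a supremum over simple functions, hence monotone on
    all nonnegative functions, measurable or not.  It is applied to the number
    of jumps of a path. *)
Lemma ge0_le_integral_total (f g : T -> \bar R) : (forall w, 0 <= f w)%E ->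
  (forall w, f w <= g w)%E -> (\int[P]_w f w <= \int[P]_w g w)%E.
Proof.
move=> f0 fg; have g0 w : (0 <= g w)%E by exact: le_trans (fg w).
rewrite !ge0_integralTE//; apply: le_ereal_sup => _ [h hf <-].
by exists h => // w; exact: le_trans (fg w).
Qed.

End Prob.

Lemma measurable_preimage d d' (T : measurableType d)
    (S : measurableType d') (f : T -> S) B :
  measurable_fun setT f -> measurable B -> measurable (f @^-1` B).
Proof. by move=> mf mB; rewrite -[X in measurable X]setTI; exact: mf. Qed.

(** * The space of real sequences *)

Section SeqSpace.
Context (R : realType).

Definition coord_sets : set (set (nat -> R)) :=
  \bigcup_n preimage_set_system setT (fun x : nat -> R => x n)
    (measurable : set (set R)).

Definition rseq := g_sigma_algebraType coord_sets.
HB.instance Definition _ := Measurable.on rseq.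

Lemma measurable_coord n : measurable_fun setT (fun y : rseq => y n).
Proof.
move=> _ B mB; apply: sub_sigma_algebra; exists n => //; exists B => //.
Qed.

Lemma measurable_to_rseq d (T : measurableType d) (f : T -> rseq) :
  (forall n, measurable_fun setT (fun w => f w n)) -> measurable_fun setT f.
Proof.
move=> mf; apply: (@measurability _ _ T rseq setT f coord_sets) => //.
move=> _ [C [n _ [B mB <-]] <-].
rewrite setTI; have := mf n measurableT B mB.
by rewrite setTI preimage_setI preimage_setT setTI.
Qed.

Definition cyl n (B : nat -> set R) : set rseq :=
  [set y | forall i, (i < n)%N -> B i (y i)].

Definition cylinders : set (set rseq) :=
  [set C | exists n B, (forall i, measurable (B i)) /\ C = cyl n B].

Lemma measurable_cyl n B : (forall i, measurable (B i)) ->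
  measurable (cyl n B).
Proof.
move=> mB; rewrite (_ : cyl n B =
    \bigcap_(i in [set i | (i < n)%N]) ((fun y : rseq => y i) @^-1` B i)).
  case: n => [|n].
    rewrite (_ : [set i | (i < 0)%N] = set0) ?bigcap_set0//.
    by apply/seteqP; split.
  apply: bigcap_measurable; first by exists 0%N.
  by move=> i _; rewrite -[X in measurable X]setTI; exact: measurable_coord.
by apply/seteqP; split => y /= H i; exact: H.
Qed.

Lemma cylinders_setI : setI_closed cylinders.
Proof.
move=> _ _ [n [B [mB ->]]] [m [C [mC ->]]].
exists (maxn n m), (fun i => (if (i < n)%N then B i else setT) `&`
                     (if (i < m)%N then C i else setT)); split.
  by move=> i; apply: measurableI; case: ifP.
apply/seteqP; split => y /=.
  by move=> [yB yC] i _; split; case: ifPn => // im; [apply: yB|apply: yC].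
move=> H; split => i im.
  by have := H i; rewrite leq_max im => /(_ isT)[].
by have := H i; rewrite leq_max im orbT => /(_ isT)[].
Qed.

Lemma cylinders_gen : (measurable : set (set rseq)) = <<s cylinders >>.
Proof.
apply/seteqP; split; last first.
  apply: smallest_sub; first exact: sigma_algebra_measurable.
  by move=> _ [n [B [mB ->]]]; exact: measurable_cyl.
apply: smallest_sub; first exact: smallest_sigma_algebra.
move=> _ [n _ [B mB <-]]; apply: sub_sigma_algebra.
exists n.+1, (fun i => if i == n then B else setT); split.
  by move=> i; case: ifP.
rewrite setTI; apply/seteqP; split => y /=.
  by move=> yB i _; case: eqVneq => // ->.
by move=> /(_ n (ltnSn n)); rewrite eqxx.
Qed.

Lemma cylinders_cover : \bigcup_(k : nat) cyl 0 (fun=> setT) = [set: rseq].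
Proof. by apply/seteqP; split => // y _; exists 0%N. Qed.

Lemma cyl0_cylinders (k : nat) : cylinders (cyl 0 (fun=> setT)).
Proof. by exists 0%N, (fun=> setT); split. Qed.

Definition seq_shift n (y : rseq) : rseq := fun i => y (n + i)%N.

(** Padding with zeros lets events on the first [n] coordinates be written
    with subsets of the whole sequence space. *)
Definition seq_trunc n (y : rseq) : rseq := fun i =>
  if (i < n)%N then y i else 0.

Lemma measurable_shift n : measurable_fun setT (seq_shift n).
Proof. by apply: measurable_to_rseq => i; exact: measurable_coord. Qed.

Lemma measurable_trunc n : measurable_fun setT (seq_trunc n).
Proof.
apply: measurable_to_rseq => i; rewrite /seq_trunc.
by case: (i < n)%N => //; exact: measurable_coord.
Qed.

End SeqSpace.

(** * Independent sequences *)

Section ProductLaw.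
Context (R : realType) (d : measure_display) (T : measurableType d)
  (P : probability T R).
Notation pr := (pr P).
Implicit Types Z : nat -> T -> R.

Definition sample Z : T -> rseq R := fun w => Z ^~ w.

Lemma measurable_sample Z : random_sequence Z -> measurable_fun setT (sample Z).
Proof. by move=> mZ; exact: measurable_to_rseq. Qed.

(** The product rule on initial segments of the index set.  Taking [B i]
    full leaves coordinate [i] free, so this is the rule for every finite set
    of indices, see [mutually_independentP]. *)
Definition indep_seq Z := forall n (B : nat -> set R),
  (forall i, measurable (B i)) ->
  pr (sample Z @^-1` cyl n B) = \prod_(i < n) pr (Z i @^-1` B i).

Lemma sample_law_unique Z Z' : random_sequence Z -> random_sequence Z' ->
  (forall n B, (forall i, measurable (B i)) ->
    pr (sample Z @^-1` cyl n B) = pr (sample Z' @^-1` cyl n B)) ->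
  forall C, measurable C -> pr (sample Z @^-1` C) = pr (sample Z' @^-1` C).
Proof.
move=> mZ mZ' H C mC.
rewrite -[sample Z @^-1` C]setTI -[RHS]mul1r.
apply: (@pr_scale_unique _ _ _ P _ _ (@cylinders R)
  (fun=> cyl 0 (fun=> setT)) (sample Z) (sample Z') setT 1) mC => //.
- exact: cylinders_gen.
- exact: cylinders_setI.
- exact: cyl0_cylinders.
- exact: cylinders_cover.
- exact: measurable_sample.
- exact: measurable_sample.
- by move=> _ [n [B [mB ->]]]; rewrite setTI mul1r; exact: H.
Qed.

Lemma indep_seq_law Z Z' : random_sequence Z -> random_sequence Z' ->
  indep_seq Z -> indep_seq Z' ->
  (forall i B, measurable B -> pr (Z i @^-1` B) = pr (Z' i @^-1` B)) ->
  forall C, measurable C -> pr (sample Z @^-1` C) = pr (sample Z' @^-1` C).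
Proof.
move=> mZ mZ' iZ iZ' ZZ'; apply: sample_law_unique => // n B mB.
by rewrite iZ// iZ'//; apply: eq_bigr => i _; exact: ZZ'.
Qed.

(** Rays are replaced with Borel sets one coordinate at a time; at each
    replacement the other coordinates form a fixed event. *)
Lemma indep_rays Z : random_sequence Z ->
  (forall n (x : nat -> R),
    pr (sample Z @^-1` cyl n (fun i => `]-oo, x i[%classic)) =
    \prod_(i < n) pr (Z i @^-1` `]-oo, x i[%classic)) ->
  indep_seq Z.
Proof.
move=> mZ H n B mB.
have main k : (k <= n)%N -> forall B : nat -> set R,
    (forall i, measurable (B i)) ->
    (forall i, (k <= i < n)%N -> exists x, B i = `]-oo, x[%classic) ->
  pr (sample Z @^-1` cyl n B) = \prod_(i < n) pr (Z i @^-1` B i).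
  elim: k {B mB} => [_ B mB Bx|k IH kn B mB Bx].
    have [x xP] : exists x : nat -> R, forall i, (i < n)%N ->
        B i = `]-oo, x i[%classic.
      have /choice[x xP] : forall i, exists x,
          (i < n)%N -> B i = `]-oo, x[%classic.
        by move=> i; case: (ltnP i n) => [/Bx[x ?]|?]; [exists x|exists 0].
      by exists x.
    transitivity (pr (sample Z @^-1` cyl n (fun i => `]-oo, x i[%classic))).
      by congr pr; apply/seteqP; split => w /= h i lin; have := h i lin;
        rewrite xP.
    by rewrite H; apply: eq_bigr => i _; rewrite xP.
  pose E := [set w | forall i, (i < n)%N -> i != k -> B i (Z i w)].
  (* Only the coordinate of index k varies. *)
  pose Bk (C : set R) i := if i == k then C else B i.
  have mBk C : measurable C -> forall i, measurable (Bk C i).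
    by move=> mC i; rewrite /Bk; case: ifP.
  have EE C : E `&` Z k @^-1` C = sample Z @^-1` cyl n (Bk C).
    apply/seteqP; split => w /=.
      move=> [Ew ZC] i ilt; rewrite /Bk; case: eqVneq => [->//|ik].
      exact: Ew.
    move=> h; split.
      by move=> i ilt /negbTE ik; have := h i ilt; rewrite /Bk ik.
    by have := h k kn; rewrite /Bk eqxx.
  have EB : sample Z @^-1` cyl n B = E `&` Z k @^-1` (B k).
    rewrite EE; congr (_ @^-1` cyl n _); apply/funext => i.
    by rewrite /Bk; case: eqVneq => // ->.
  pose c := \prod_(i < n | i != Ordinal kn) pr (Z i @^-1` B i).
  have prodE C : \prod_(i < n) pr (Z i @^-1` Bk C i) = c * pr (Z k @^-1` C).
    rewrite (bigD1 (Ordinal kn))//= /Bk eqxx mulrC; congr (_ * _).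
    by apply: eq_bigr => i; rewrite -val_eqE /= => /negbTE ->.
  rewrite EB (_ : \prod_(_ < n) _ = c * pr (Z k @^-1` B k)); last first.
    rewrite -prodE; apply: eq_bigr => i _; congr (pr (_ @^-1` _)).
    by rewrite /Bk; case: eqVneq => // ->.
  apply: (@pr_scale_unique _ _ _ P _ _ (@RGenInftyO.G R)
    (fun k => `]-oo, k%:R[%classic) (Z k) (Z k) E c) => //.
  - exact: RGenInftyO.measurableE.
  - move=> _ _ [x ->] [y ->]; exists (Num.min x y).
    by apply/seteqP; split => z /=; rewrite !in_itv /= lt_min => /andP.
  - by move=> i; exists i%:R.
  - apply/seteqP; split => // x _; exists (Num.truncn x).+1 => //=.
    by rewrite in_itv /= truncnS_gt.
  - rewrite (_ : E = sample Z @^-1` cyl n (Bk setT)).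
      by apply: measurable_preimage;
        [exact: measurable_sample|apply: measurable_cyl; apply: mBk].
    by rewrite -EE preimage_setT setIT.
  - by apply: prodr_ge0 => i _; exact: pr_ge0.
  - move=> _ [x ->]; rewrite EE -prodE; apply: (IH (ltnW kn)).
      exact: mBk.
    move=> i /andP[ki ilt]; rewrite /Bk; case: eqVneq => [_|ik];
      first by exists x.
    by apply: Bx; rewrite ilt andbT ltn_neqAle eq_sym ik.
apply: (main n) => // i.
by rewrite leqNgt andNb.
Qed.

(** On cylinders this is the product rule; one then extends first the
    future and then the past by measure uniqueness. *)
Lemma indep_past_future Z n (E F : set (rseq R)) : random_sequence Z ->
  indep_seq Z -> measurable E -> measurable F ->
  pr (sample Z @^-1` (seq_trunc n @^-1` E) `&`
    sample Z @^-1` (seq_shift n @^-1` F)) =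
  pr (sample Z @^-1` (seq_trunc n @^-1` E)) * pr (sample Z @^-1` (seq_shift n
    @^-1` F)).
Proof.
move=> mZ iZ mE mF.
have mt : measurable_fun setT (fun w => seq_trunc n (sample Z w)).
  by apply: measurableT_comp (@measurable_trunc R n) _;
    exact: measurable_sample.
have ms : measurable_fun setT (fun w => seq_shift n (sample Z w)).
  by apply: measurableT_comp (@measurable_shift R n) _;
    exact: measurable_sample.
rewrite -[sample Z @^-1` (seq_trunc n @^-1` E)]/((seq_trunc n \o sample Z)
  @^-1` E).
rewrite -[sample Z @^-1` (seq_shift n @^-1` F)]/((seq_shift n \o sample Z)
  @^-1` F).
apply: (@pr_scale_unique _ _ _ P _ _ (@cylinders R)
  (fun=> cyl 0 (fun=> setT)) _ _ _ (pr _)) mF => //.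
- exact: cylinders_gen.
- exact: cylinders_setI.
- exact: cyl0_cylinders.
- exact: cylinders_cover.
- exact: measurable_preimage.
- exact: pr_ge0.
move=> _ [k [C [mC ->]]].
rewrite setIC mulrC.
apply: (@pr_scale_unique _ _ _ P _ _ (@cylinders R)
  (fun=> cyl 0 (fun=> setT)) _ _ _ (pr _)) mE => //.
- exact: cylinders_gen.
- exact: cylinders_setI.
- exact: cyl0_cylinders.
- exact: cylinders_cover.
- by apply: measurable_preimage => //; exact: measurable_cyl.
- exact: pr_ge0.
move=> _ [m [B [mB ->]]].
(* The padding zeros satisfy all the constraints on them or make the event
   empty. *)
have [pad|npad] := pselect (forall i, (n <= i < m)%N -> B i 0); last first.
  rewrite (_ : (seq_trunc n \o sample Z) @^-1` cyl m B =
    set0) ?setI0 ?pr_set0 ?mulr0//.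
  apply/seteqP; split => // w /= h; apply: npad => i /andP[ni im].
  by have := h i im; rewrite /seq_trunc ltnNge ni.
pose B' i := if (i < m)%N then B i else setT.
have mB' i : measurable (B' i) by rewrite /B'; case: ifP.
pose D i := if (i < n)%N then B' i else C (i - n)%N.
have mD i : measurable (D i) by rewrite /D; case: ifP.
have -> : (seq_trunc n \o sample Z) @^-1` cyl m B = sample Z @^-1` cyl n B'.
  apply/seteqP; split => w /= h i.
    by move=> ilt; rewrite /B'; case: ifP => // im; have := h i im;
      rewrite /seq_trunc ilt.
  move=> im; rewrite /seq_trunc; case: ifPn => ilt.
    by have := h i ilt; rewrite /B' im.
  by apply: pad; rewrite leqNgt ilt.
pose D2 i := if (i < n)%N then setT else C (i - n)%N.
have mD2 i : measurable (D2 i) by rewrite /D2; case: ifP.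
have -> : (seq_shift n \o sample Z) @^-1` cyl k C =
  sample Z @^-1` cyl (n + k) D2.
  apply/seteqP; split => w /= h i.
    move=> ilt; rewrite /D2; case: (ltnP i n) => // ni.
    by have := h (i - n)%N; rewrite ltn_subLR// => /(_ ilt);
      rewrite /seq_shift subnKC.
  move=> ik; have := h (n + i)%N; rewrite ltn_add2l => /(_ ik).
  by rewrite /D2 ltnNge leq_addr addKn.
have -> : sample Z @^-1` cyl (n + k) D2 `&` sample Z @^-1` cyl n B' =
    sample Z @^-1` cyl (n + k) D.
  apply/seteqP; split => w /=.
    move=> [hD hB] i ink; rewrite /D; case: ifPn => ilt; first exact: hB.
    by have := hD i ink; rewrite /D2 (negbTE ilt).
  move=> h; split => i ilt.
    by rewrite /D2; case: ifPn => // hn; have := h i ilt;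
      rewrite /D (negbTE hn).
  by have := h i (ltn_addr _ ilt); rewrite /D ilt.
rewrite !iZ//.
have prT i : pr (Z i @^-1` setT) = 1 by rewrite preimage_setT pr_setT.
rewrite !big_split_ord /=.
rewrite [X in _ = X * _ * _]big1; last first.
  by move=> i _; rewrite /D2 /= ltn_ord prT.
rewrite mul1r mulrC; congr (_ * _); apply: eq_bigr => i _.
  by rewrite /D /D2 !ltnNge leq_addr.
by rewrite /D ltn_ord.
Qed.

Lemma shift_indep Z n : random_sequence Z -> indep_seq Z ->
  indep_seq (fun i => Z (n + i)%N).
Proof.
move=> mZ iZ k B mB.
pose D2 i := if (i < n)%N then setT else B (i - n)%N.
have mD2 i : measurable (D2 i) by rewrite /D2; case: ifP.
have -> : sample (fun i => Z (n + i)%N) @^-1` cyl k B =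
  sample Z @^-1` cyl (n + k) D2.
  apply/seteqP; split => w /= h i.
    move=> ilt; rewrite /D2; case: (ltnP i n) => // ni.
    by have := h (i - n)%N; rewrite ltn_subLR// => /(_ ilt);
      rewrite /sample subnKC.
  move=> ik; have := h (n + i)%N; rewrite ltn_add2l => /(_ ik).
  by rewrite /D2 ltnNge leq_addr addKn.
rewrite iZ// big_split_ord /= big1 ?mul1r; last first.
  by move=> i _; rewrite /D2 ltn_ord preimage_setT pr_setT.
by apply: eq_bigr => i _; rewrite /D2 /= ltnNge leq_addr addKn.
Qed.

Lemma mutually_independentP Z : random_sequence Z ->
  mutually_independent P Z <-> indep_seq Z.
Proof.
move=> mZ; split => [mi n B mB|iZ F B mB].
  pose F := [fset i in iota 0 n]%fset.
  have := mi F B mB.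
  rewrite (_ : \bigcap_(i in _) _ = sample Z @^-1` cyl n B); last first.
    apply/seteqP; split => w /= h i.
      by move=> ilt; apply: h => /=; rewrite inE mem_iota.
    by rewrite /= inE mem_iota => ilt; exact: h.
  rewrite (perm_big (iota 0 n)) /=; last first.
    apply: uniq_perm; rewrite ?fset_uniq ?iota_uniq//.
    by move=> i; rewrite inE.
  rewrite -[X in iota 0 X]subn0 -/(index_iota 0 n) big_mkord => PE.
  rewrite /pr PE.
  rewrite (eq_bigr (fun i => (pr (Z (nat_of_ord i) @^-1` B i))%:E)).
    by rewrite prodEFin.
  by move=> i _; rewrite prE//; exact: measurable_preimage.
have [n Fn] : exists n, forall i, i \in F -> (i < n)%N.
  exists (\max_(i <- F) i).+1 => i.
  by move=> iF; rewrite ltnS; exact: (leq_bigmax_seq (F := fun i => i)).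
pose D i := if i \in F then B i else setT.
have mD i : measurable (D i) by rewrite /D; case: ifP.
have := iZ n D mD.
rewrite (_ : sample Z @^-1` cyl n D = \bigcap_(i in [set` F]) (Z i @^-1` B i));
  last first.
  apply/seteqP; split => w /= h i.
    by move=> iF; have := h i (Fn _ iF); rewrite /D iF.
  by move=> ilt; rewrite /D; case: ifP => // iF; exact: h.
move=> prB.
have mI : measurable (\bigcap_(i in [set` F]) (Z i @^-1` B i)).
  by apply: fin_bigcap_measurable => // i _; exact: measurable_preimage.
rewrite prE// prB.
rewrite [RHS](eq_bigr (fun i => (pr (Z i @^-1` B i))%:E)); last first.
  by move=> i _; rewrite prE//; exact: measurable_preimage.
rewrite prodEFin; congr EFin.
rewrite -(big_mkord xpredT (fun i => pr (Z i @^-1` D i))) /index_iota subn0.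
rewrite (bigID (mem F)) /= [X in _ * X]big1 ?mulr1; last first.
  by move=> i /negbTE iF; rewrite /D iF preimage_setT pr_setT.
rewrite -big_filter.
rewrite (perm_big F); last first.
  apply: uniq_perm; rewrite ?filter_uniq ?iota_uniq ?fset_uniq//.
  move=> i; rewrite mem_filter mem_iota /= add0n.
  by case iF : (i \in F) => //=; rewrite Fn.
by rewrite big_seq [RHS]big_seq; apply: eq_bigr => i iF; rewrite /D iF.
Qed.

Lemma indep_opp Z : indep_seq Z -> indep_seq (fun i w => - Z i w).
Proof.
move=> iZ n B mB.
have mB' i : measurable (-%R @^-1` B i).
  by apply: measurable_preimage => //; exact: oppr_measurable.
exact: (iZ n (fun i => -%R @^-1` B i) mB').
Qed.

(** An index that [s] does not reach receives the full set and
    contributes a factor 1. *)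
Lemma indep_reindex Z (s : nat -> nat) : random_sequence Z -> injective s ->
  indep_seq Z -> indep_seq (fun i => Z (s i)).
Proof.
move=> mZ sI iZ n B mB.
pose N := (\max_(i < n) s i).+1.
have sN (i : 'I_n) : (s i < N)%N by rewrite ltnS;
  exact: (leq_bigmax_cond (F := fun i : 'I_n => s i)).
pose s' i := Ordinal (sN i).
(* B' (s i) = B i, and B' is full outside the image of s. *)
pose B' j := if [pick i : 'I_n | s i == j] is Some i then B i else setT.
have mB' j : measurable (B' j) by rewrite /B'; case: pickP.
have B's (i : 'I_n) : B' (s i) = B i.
  rewrite /B'; case: pickP => [k /eqP/sI/val_inj ->//|/(_ i)].
  by rewrite eqxx.
have B'n j : (forall i : 'I_n, s i != j) -> B' j = setT.
  by rewrite /B' => h; case: pickP => // i; rewrite (negbTE (h i)).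
transitivity (pr (sample Z @^-1` cyl N B')).
  congr pr; apply/seteqP; split => w /= h i ilt.
    rewrite /B'; case: pickP => // k /eqP <-; exact: h.
  by have := h (s i) (sN (Ordinal ilt)); rewrite (B's (Ordinal ilt)).
rewrite iZ// (bigID (mem [set s' i | i : 'I_n]%SET)) /=.
rewrite [X in _ * X]big1 ?mulr1; last first.
  move=> j /imsetP nj; rewrite B'n ?preimage_setT ?pr_setT// => i.
  by apply/eqP => ij; apply: nj; exists i => //; exact: val_inj.
rewrite big_imset /=; last by move=> i j _ _ /(congr1 val) /sI /val_inj.
by apply: eq_bigr => i _; rewrite B's.
Qed.

End ProductLaw.

(** * Blocks of a sequence with marks *)

Lemma measurable_fun_select d d' (S : measurableType d) (U : measurableType d')
    (f : nat -> S -> U) (c : S -> nat) :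
  (forall i, measurable_fun setT (f i)) ->
  (forall i, measurable (c @^-1` [set i])) ->
  measurable_fun setT (fun s => f (c s) s).
Proof.
move=> mf mc _ B mB; rewrite setTI.
rewrite (_ : _ @^-1` B = \bigcup_i (c @^-1` [set i] `&` f i @^-1` B)).
  apply: bigcupT_measurable => i; apply: measurableI => //.
  exact: measurable_preimage.
apply/seteqP; split => s /=; first by move=> fB; exists (c s).
by move=> [i _ [/= -> ]].
Qed.

Section PathFunctionals.
Context (R : realType).
Implicit Types y : rseq R.

Definition psum y n : R := \sum_(i < n) y i.

Fixpoint pmax y n : R :=
  if n is m.+1 then Num.max (pmax y m) (psum y n) else 0.

Lemma psum0 y : psum y 0 = 0.
Proof. by rewrite /psum big_ord0. Qed.

Lemma psumD y m n : psum y (m + n) = psum y m + psum (seq_shift m y) n.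
Proof. by rewrite /psum big_split_ord. Qed.

Lemma le_pmax y n j : (j <= n)%N -> psum y j <= pmax y n.
Proof.
elim: n => [|n IH]; first by rewrite leqn0 => /eqP ->; rewrite psum0.
rewrite leq_eqVlt => /predU1P[->|]; first by rewrite /= le_max lexx orbT.
by rewrite ltnS => /IH h; rewrite /= le_max h.
Qed.

Lemma pmax_attained y n : exists2 j, (j <= n)%N & pmax y n = psum y j.
Proof.
elim: n => [|n [j jn IH]]; first by exists 0%N => //; rewrite psum0.
rewrite /=; case: leP => _; first by exists n.+1.
by exists j => //; exact: leqW.
Qed.

Lemma measurable_psum n : measurable_fun setT (psum ^~ n).
Proof.
apply: measurable_sum => i; exact: measurable_coord.
Qed.

Lemma measurable_pmax n : measurable_fun setT (pmax ^~ n).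
Proof.
elim: n => [|n IH]; first exact: measurable_cst.
by apply: measurable_maxr => //; exact: measurable_psum.
Qed.

Lemma psum_trunc y n j : (j <= n)%N -> psum (seq_trunc n y) j = psum y j.
Proof.
move=> jn; apply: eq_bigr => i _; rewrite /seq_trunc.
by rewrite (leq_trans (ltn_ord i) jn).
Qed.

Context (A : set R).

Definition first_mark i : set (rseq R) :=
  [set y | A (y i) /\ forall j, (j < i)%N -> ~ A (y j)].

Definition marked : set (rseq R) := [set y | exists i, A (y i)].

Lemma marked_first y : marked y -> exists i, first_mark i y.
Proof.
move=> [i Ai]; elim/ltn_ind: i Ai => i IH Ai.
have [[j ji Aj]|h] := pselect (exists2 j, (j < i)%N & A (y j)).
  exact: IH Aj.
by exists i; split => // j ji Aj; apply: h; exists j.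
Qed.

Lemma first_mark_uniq y i j : first_mark i y -> first_mark j y -> i = j.
Proof.
move=> [Ai hi] [Aj hj]; case: (ltngtP i j) => // [/hj|/hi] //.
Qed.

Definition mark_index y : nat := xget 0%N (first_mark ^~ y).

Lemma mark_indexE y i : first_mark i y -> mark_index y = i.
Proof.
move=> yi; rewrite /mark_index; case: xgetP => [j _ yj|/(_ i)]; last by [].
exact: first_mark_uniq yj yi.
Qed.

Definition block_rise y := pmax y (mark_index y).
(** The marked step that ends the block belongs to the fall. *)
Definition block_fall y := psum y (mark_index y).+1 - block_rise y.
Definition next_block y : rseq R := seq_shift (mark_index y).+1 y.

(** The rise of block [k] has index [2k] and its fall has index [2k + 1], so
    that a single independence statement covers both. *)
Definition rise_fall i y :=
  let z := iter i./2 next_block y in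
  if odd i then block_fall z else block_rise z.

Lemma rise_fallSS i y : rise_fall i.+2 y = rise_fall i (next_block y).
Proof. by rewrite /rise_fall /= negbK -iterS iterSr. Qed.

Hypothesis mA : measurable A.

Lemma measurable_coord_pre i B : measurable B ->
  measurable ([set y : rseq R | B (y i)]).
Proof. by move=> mB; exact: (measurable_preimage (@measurable_coord R i)). Qed.

Lemma measurable_unmarked i :
  measurable [set y : rseq R | forall j, (j < i)%N -> ~ A (y j)].
Proof.
exact: (@measurable_cyl R i (fun=> ~` A) (fun=> measurableC mA)).
Qed.

Lemma measurable_first_mark i : measurable (first_mark i).
Proof.
apply: measurableI; first exact: measurable_coord_pre.
exact: measurable_unmarked.
Qed.

Lemma measurable_marked : measurable marked.
Proof.
rewrite (_ : marked = \bigcup_i [set y : rseq R | A (y i)]).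
  by apply: bigcupT_measurable => i; exact: measurable_coord_pre.
by apply/seteqP; split => y [i]; [move=> ?; exists i|exists i].
Qed.

Lemma measurable_mark_index i : measurable (mark_index @^-1` [set i]).
Proof.
rewrite (_ : _ @^-1` _ = first_mark i `|`
   (if i == 0%N then ~` marked else set0)).
  apply: measurableU; first exact: measurable_first_mark.
  by case: ifP => _ //; apply: measurableC; exact: measurable_marked.
apply/seteqP; split => y /=.
  have [my|nmy] := pselect (marked y).
    by have [j yj] := marked_first my; rewrite (mark_indexE yj) => <-; left.
  move=> <-; right; rewrite /mark_index; case: xgetP => [j _ [Aj _]|_] /=.
    by exfalso; apply: nmy; exists j.
  by [].
move=> [/mark_indexE //|]; case: eqP => // -> nmy.
rewrite /mark_index; case: xgetP => // j _ [Aj _].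
by exfalso; apply: nmy; exists j.
Qed.

Lemma measurable_block_rise : measurable_fun setT block_rise.
Proof.
apply: (measurable_fun_select (f := fun n y => pmax y n)).
  exact: measurable_pmax.
exact: measurable_mark_index.
Qed.

Lemma measurable_block_fall : measurable_fun setT block_fall.
Proof.
apply: measurable_funB; last exact: measurable_block_rise.
apply: (measurable_fun_select (f := fun n y => psum y n.+1)).
  by move=> i; exact: measurable_psum.
exact: measurable_mark_index.
Qed.

Lemma measurable_next : measurable_fun setT next_block.
Proof.
apply: (measurable_fun_select (f := fun n y => seq_shift n.+1 y)).
  by move=> i; exact: measurable_shift.
exact: measurable_mark_index.
Qed.

Lemma measurable_rise_fall i : measurable_fun setT (rise_fall i).
Proof.
have mn k : measurable_fun setT (iter k next_block).
  elim: k => [|k IH]; first exact: measurable_id.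
  by apply: (measurableT_comp measurable_next IH).
rewrite /rise_fall; case: (odd i).
  exact: (measurableT_comp measurable_block_fall (mn _)).
exact: (measurableT_comp measurable_block_rise (mn _)).
Qed.

(** Strictness makes [g] the first time at which the maximum of the block is
    attained, and therefore unique. *)
Definition pre_max g (a : set R) : set (rseq R) :=
  [set y | [/\ forall i, (i < g)%N -> ~ A (y i),
               forall j, (j < g)%N -> psum y j < psum y g & a (psum y g)]].

(** What follows the maximum: the sums stay nonpositive up to the marked
    step, which itself may go up. *)
Definition post_max l (b : set R) : set (rseq R) :=
  [set y | [/\ first_mark l y,
               forall j, (j <= l)%N -> psum y j <= 0 & b (psum y l.+1)]].

Lemma measurable_pre_max g a : measurable a -> measurable (pre_max g a).
Proof.
move=> ma.
rewrite (_ : pre_max g a =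
  [set y : rseq R | forall j, (j < g)%N -> ~ A (y j)] `&`
  (\bigcap_j ([set y : rseq R | (j < g)%N -> psum y j < psum y g])) `&`
  (psum ^~ g @^-1` a)).
  apply: measurableI; last by apply: measurable_preimage => //;
    exact: measurable_psum.
  apply: measurableI; first exact: measurable_unmarked.
  apply: bigcapT_measurable => j.
  case: (j < g)%N; last first.
    by rewrite (_ : [set _ | _] = setT)//; apply/seteqP; split.
  rewrite (_ : [set _ | _] =
    (fun y : rseq R => psum y j < psum y g) @^-1` [set true]).
    by apply: measurable_preimage => //; apply: measurable_fun_ltr;
      exact: measurable_psum.
  by apply/seteqP; split => y /=; [move=> ->|move=> h _].
apply/seteqP; split => y /=.
  by move=> [h1 h2 h3]; split => //; split => // j _; exact: h2.
by move=> [[h1 h2] h3]; split => // j; exact: h2.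
Qed.

Lemma measurable_post_max l b : measurable b -> measurable (post_max l b).
Proof.
move=> mb.
rewrite (_ : post_max l b = first_mark l `&`
  (\bigcap_j ([set y : rseq R | (j <= l)%N -> psum y j <= 0])) `&`
  (psum ^~ l.+1 @^-1` b)).
  apply: measurableI; last by apply: measurable_preimage => //;
    exact: measurable_psum.
  apply: measurableI; first exact: measurable_first_mark.
  apply: bigcapT_measurable => j.
  case: (j <= l)%N; last first.
    by rewrite (_ : [set _ | _] = setT)//; apply/seteqP; split.
  rewrite (_ : [set _ | _] =
    (fun y : rseq R => psum y j <= 0) @^-1` [set true]).
    apply: measurable_preimage => //; apply: measurable_fun_ler;
      first exact: measurable_psum.
    exact: measurable_cst.
  by apply/seteqP; split => y /=; [move=> ->|move=> h _].
apply/seteqP; split => y /=.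
  by move=> [h1 h2 h3]; split => //; split => // j _; exact: h2.
by move=> [[h1 h2] h3]; split => // j; exact: h2.
Qed.

(** With [post_max_trunc], this makes the part of a block before its maximum
    independent of the part after it. *)
Lemma pre_max_trunc g a : seq_trunc g @^-1` pre_max g a = pre_max g a.
Proof.
have tr y i : (i < g)%N -> seq_trunc g y i = y i by rewrite /seq_trunc => ->.
apply/seteqP; split => y [/= h1 h2 h3]; split.
- by move=> i ig; have := h1 i ig; rewrite tr.
- move=> j jg; have := h2 j jg.
  by rewrite !psum_trunc// ltnW.
- by rewrite psum_trunc// in h3.
- by move=> i ig; rewrite tr; [exact: h1|].
- move=> j jg; have := h2 j jg.
  by rewrite !psum_trunc// ltnW.
- by rewrite psum_trunc.
Qed.

Lemma post_max_trunc l b : seq_trunc l.+1 @^-1` post_max l b = post_max l b.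
Proof.
have tr y i : (i <= l)%N -> seq_trunc l.+1 y i =
  y i by rewrite /seq_trunc ltnS => ->.
apply/seteqP; split => y [/= [h0 h1] h2 h3]; split.
- rewrite tr// in h0; split => // j jl; have := h1 j jl.
  by rewrite tr// ltnW.
- by move=> j jl; have := h2 j jl; rewrite psum_trunc// leqW.
- by rewrite psum_trunc// in h3.
- split; first by rewrite tr.
  by move=> j jl; rewrite tr; [exact: h1|exact: ltnW].
- by move=> j jl; rewrite psum_trunc; [exact: h2|exact: leqW].
- by rewrite psum_trunc.
Qed.

Definition block g l : set (rseq R) :=
  pre_max g setT `&` seq_shift g @^-1` post_max l setT.

Lemma block_first_mark g l y : block g l y -> first_mark (g + l) y.
Proof.
move=> [[h1 _ _] [[hA h2] _ _]]; split; first exact: hA.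
move=> j jgl; case: (ltnP j g) => [/h1//|gj].
have := h2 (j - g)%N; rewrite ltn_subLR// => /(_ jgl).
by rewrite /seq_shift subnKC.
Qed.

Lemma block_pmax g l y : block g l y -> pmax y (g + l) = psum y g.
Proof.
move=> [[_ h1 _] [_ h2 _]]; apply/eqP; rewrite eq_le le_pmax ?leq_addr// andbT.
have [j jn ->] := pmax_attained y (g + l).
case: (ltnP j g) => [/h1/ltW//|gj].
have := h2 (j - g)%N; rewrite leq_subLR => /(_ jn).
by move=> ?; rewrite -(subnKC gj) psumD gerDl.
Qed.

(** Both cuts give the same maximum, and an earlier sum is strictly below
    it. *)
Lemma block_inj g l g' l' y : block g l y -> block g' l' y -> g = g' /\ l = l'.
Proof.
move=> b b'; have e : (g + l)%N = (g' + l')%N.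
  exact: first_mark_uniq (block_first_mark b) (block_first_mark b').
suff gg : g = g' by split => //; move: e; rewrite gg => /addnI.
have pp : psum y g = psum y g' by rewrite -(block_pmax b) -(block_pmax b') e.
case: (ltngtP g g') => // gg.
  by have [[_ /(_ _ gg)]] := b'; rewrite pp ltxx.
by have [[_ /(_ _ gg)]] := b; rewrite pp ltxx.
Qed.

Lemma marked_block y : marked y -> exists g l, block g l y.
Proof.
move=> /marked_first[n [An hn]].
pose Q g := (g <= n)%N && (psum y g == pmax y n).
have exQ : exists g, Q g.
  have [j jn e] := pmax_attained y n; exists j; rewrite /Q jn e eqxx//.
case: (ex_minnP exQ) => g /andP[gn /eqP gE] gmin.
exists g, (n - g)%N; split; split => //.
- by move=> i ig; apply: hn; exact: leq_trans ig gn.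
- move=> j jg; rewrite gE lt_neqAle le_pmax ?andbT; last first.
    by rewrite (leq_trans _ gn)// ltnW.
  apply/negP => jE; suff : (g <= j)%N by rewrite leqNgt jg.
  by apply: gmin; rewrite /Q jE andbT (leq_trans _ gn)// ltnW.
- split; first by rewrite /seq_shift subnKC.
  by move=> j jl; apply: hn; rewrite -ltn_subRL.
- move=> j jl; have := @le_pmax y n (g + j); rewrite -leq_subRL// => /(_ jl).
  by rewrite psumD -gE gerDl.
Qed.

Lemma blockE g l y : block g l y ->
  [/\ mark_index y = (g + l)%N, block_rise y = psum y g, block_fall y =
    psum (seq_shift g y) l.+1 &
      next_block y = seq_shift l.+1 (seq_shift g y)].
Proof.
move=> b; have k := mark_indexE (block_first_mark b).
have a : block_rise y = psum y g by rewrite /block_rise k block_pmax.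
split => //; first by rewrite /block_fall k a -addnS psumD addrC addKr.
rewrite /next_block k; apply/funext => i.
by rewrite /seq_shift -addnS addnA.
Qed.

End PathFunctionals.

(** * The factorisation for random walks with marks *)

Section DiscreteWienerHopf.
Context (R : realType) (d : measure_display) (T : measurableType d)
  (P : probability T R) (A : set R) (Y : nat -> T -> R).
Hypotheses (mA : measurable A) (mY : random_sequence Y) (iY : indep_seq P Y)
  (eY : forall i B, measurable B -> pr P (Y i @^-1` B) = pr P (Y 0%N @^-1` B))
  (A0 : 0 < pr P (Y 0%N @^-1` A)).
Notation pr := (pr P).
Notation W := (sample Y).

Lemma measurable_sampleW C : measurable C -> measurable (W @^-1` C).
Proof. by apply: measurable_preimage; exact: measurable_sample. Qed.

Lemma pr_shift n F : measurable F ->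
  pr (W @^-1` (seq_shift n @^-1` F)) = pr (W @^-1` F).
Proof.
move=> mF.
rewrite -[W @^-1` (seq_shift n @^-1` F)]/(sample (fun i =>
  Y (n + i)%N) @^-1` F).
apply: indep_seq_law => //.
- exact: shift_indep.
- by move=> i B mB; rewrite eY// [RHS]eY.
Qed.

(** Each step is marked with the same positive probability. *)
Lemma pr_unmarked : pr (W @^-1` (~` marked A)) = 0.
Proof.
pose p := pr (Y 0%N @^-1` A).
pose F n := W @^-1` cyl n (fun=> ~` A).
have mF n : measurable (F n).
  by apply: measurable_sampleW; apply: measurable_cyl => _; exact: measurableC.
have prF n : pr (F n) = (1 - p) ^+ n.
  rewrite /F iY; last by move=> _; exact: measurableC.
  rewrite (eq_bigr (fun=> 1 - p)) ?prodr_const ?card_ord// => i _.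
  rewrite eY; last exact: measurableC.
  by rewrite preimage_setC prC//; exact: measurable_preimage.
have niF : nonincreasing_seq F.
  move=> m n mn; apply/subsetPset => w Fw i im; apply: Fw.
  exact: leq_trans im mn.
have := pr_cvg_down (P := P) mF niF.
have -> : \bigcap_n F n = W @^-1` (~` marked A).
  apply/seteqP; split => w /= h; first by move=> [i]; apply: (h i.+1 I i).
  by move=> n _ i _ Ai; apply: h; exists i.
under eq_fun do rewrite prF.
have p1 : p <= 1 by apply: pr_le1; exact: measurable_preimage.
move=> h1; have : (1 - p) ^+ n @[n --> \oo] --> (0 : R).
  apply: cvg_expr; rewrite ger0_norm ?subr_ge0//.
  by rewrite ltrBlDr ltrDl.
by move=> /(cvg_unique _ h1) ->.
Qed.

Local Open Scope ereal_scope.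

Let U a : \bar R := \sum_(g <oo) P (W @^-1` pre_max A g a).
Let V b : \bar R := \sum_(l <oo) P (W @^-1` post_max A l b).

(** The three conditions bear on the first [g] steps, on the next [l.+1]
    steps and on the remaining ones. *)
Lemma P_block g l a b F : measurable a -> measurable b -> measurable F ->
  P (W @^-1` (pre_max A g a `&` seq_shift g @^-1` (post_max A l b `&`
     seq_shift l.+1 @^-1` F))) =
  P (W @^-1` pre_max A g a) * (P (W @^-1` post_max A l b) * P (W @^-1` F)).
Proof.
move=> ma mb mF.
have mE := measurable_pre_max mA g ma.
have mQ := measurable_post_max mA l mb.
have mF' : measurable (seq_shift l.+1 @^-1` F).
  by apply: measurable_preimage => //; exact: measurable_shift.
have mQF := measurableI _ _ mQ mF'.
have mG : measurable (seq_shift g @^-1` (post_max A l b `&`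
  seq_shift l.+1 @^-1` F)).
  by apply: measurable_preimage => //; exact: measurable_shift.
rewrite !(prE P)//; try exact: measurable_sampleW; last first.
  by apply: measurable_sampleW; exact: measurableI.
rewrite -!EFinM; congr EFin.
rewrite preimage_setI -{1}(pre_max_trunc A g a) indep_past_future//.
rewrite pre_max_trunc pr_shift//; congr (_ * _)%R.
rewrite preimage_setI -{1}(post_max_trunc A l b) indep_past_future//.
by rewrite post_max_trunc pr_shift.
Qed.

(** The events are disjoint since the first mark is unique, so their
    probabilities add up to at most 1. *)
Lemma V_fin b : measurable b -> V b = (fine (V b))%:E.
Proof.
move=> mb; have mp l : measurable (W @^-1` post_max A l b).
  by apply: measurable_sampleW; exact: measurable_post_max.
rewrite fineK// (_ : V b = P (\bigcup_l (W @^-1` post_max A l b))).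
  by rewrite fin_num_measure//; exact: bigcupT_measurable.
symmetry; apply: measure_semi_bigcup => //; last exact: bigcupT_measurable.
move=> l l' _ _ [w [[h1 _ _] [h2 _ _]]].
exact: first_mark_uniq h1 h2.
Qed.

(** The Wiener-Hopf factorisation: up to a null event the left-hand side is
    the disjoint union over [g] and [l] of the events of [P_block]. *)
Lemma blocks_factor a b F : measurable a -> measurable b -> measurable F ->
  P (W @^-1` (block_rise A @^-1` a `&` block_fall A @^-1` b `&`
    next_block A @^-1` F)) =
  U a * (V b * P (W @^-1` F)).
Proof.
move=> ma mb mF.
pose D g l := pre_max A g a `&` seq_shift g @^-1` (post_max A l b `&`
     seq_shift l.+1 @^-1` F).
have mD g l : measurable (W @^-1` D g l).
  apply: measurable_sampleW; apply: measurableI;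
    first exact: measurable_pre_max.
  apply: measurable_preimage; first exact: measurable_shift.
  apply: measurableI; first exact: measurable_post_max.
  by apply: measurable_preimage => //; exact: measurable_shift.
have Dblock g l y : D g l y -> block A g l y.
  by move=> [[h1 h2 h3] [[h4 h5 h6] h7]]; split; split.
have DE : marked A `&` (block_rise A @^-1` a `&` block_fall A @^-1` b `&`
  next_block A @^-1` F) =
    \bigcup_g \bigcup_l D g l.
  apply/seteqP; split => y.
    move=> [/marked_block[g [l bl]] /= [[ya yb] yF]].
    have [k ea eb en] := blockE bl.
    exists g => //; exists l => //.
    case: bl => [[h1 h2 _] [h3 h4 _]].
    split; first by split => //; rewrite -ea.
    split; last by rewrite /preimage /= -en.
    by split => //; rewrite -eb.
  move=> [g _ [l _ yD]]; have bl := Dblock _ _ _ yD.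
  have [k ea eb en] := blockE bl.
  split; first by have [h _] := block_first_mark bl; exists (g + l)%N.
  case: yD => [[_ _ h1] [[_ _ h2] h3]].
  by rewrite /= ea eb en; split.
have mE : measurable (block_rise A @^-1` a `&` block_fall A @^-1` b `&`
  next_block A @^-1` F).
  apply: measurableI; first apply: measurableI.
  - by apply: measurable_preimage => //; exact: measurable_block_rise.
  - by apply: measurable_preimage => //; exact: measurable_block_fall.
  - by apply: measurable_preimage => //; exact: measurable_next.
have mM := measurable_marked mA.
transitivity (P (\bigcup_g \bigcup_l (W @^-1` D g l))).
  have -> : \bigcup_g \bigcup_l (W @^-1` D g l) = W @^-1` (marked A `&`
      (block_rise A @^-1` a `&` block_fall A @^-1` b `&` next_block A @^-1` F)).
    by rewrite DE preimage_bigcup; apply: eq_bigcupr => g _;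
      rewrite preimage_bigcup.
  apply/eqP; rewrite eq_le; apply/andP; split; last first.
    apply: le_measure; rewrite ?inE; try apply: measurable_sampleW => //.
      exact: measurableI.
    by apply: preimage_subset; exact: subIsetr.
  set E := (X in P (W @^-1` X)) in mE *.
  have -> : W @^-1` E = W @^-1` (marked A `&` E) `|` W @^-1` (~` marked A `&`
    E).
    by rewrite -preimage_setU -setIUl setUv setTI.
  have mC := measurableC mM.
  have m1 : measurable (W @^-1` (marked A `&` E)).
    by apply: measurable_sampleW; exact: measurableI.
  have m2 : measurable (W @^-1` (~` marked A `&` E)).
    by apply: measurable_sampleW; exact: measurableI.
  have P0 : P (W @^-1` (~` marked A `&` E)) = 0.
    apply/eqP; rewrite eq_le measure_ge0 andbT.
    have <- : P (W @^-1` (~` marked A)) = 0.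
      by rewrite prE ?pr_unmarked//; exact: measurable_sampleW.
    apply: le_measure; rewrite ?inE//; first exact: measurable_sampleW.
    by apply: preimage_subset; exact: subIsetl.
  have : P (W @^-1` (marked A `&` E) `|` W @^-1` (~` marked A `&` E)) <=
    P (W @^-1` (marked A `&` E)) + P (W @^-1` (~` marked A `&` E)).
    exact: measureU2.
  by rewrite P0 adde0.
have trD g l g' l' : (W @^-1` D g l `&` W @^-1` D g' l') !=set0 ->
    g = g' /\ l = l'.
  move=> [w [/Dblock b1 /Dblock b2]]; exact: block_inj b1 b2.
have mDg g : measurable (\bigcup_l (W @^-1` D g l)).
  exact: bigcupT_measurable.
transitivity (\sum_(g <oo) P (\bigcup_l (W @^-1` D g l))).
  apply: measure_semi_bigcup => //; last exact: bigcupT_measurable.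
  move=> g g' _ _ [w [[l _ h1] [l' _ h2]]].
  by have [] : g = g' /\ l = l' by apply: trD; exists w.
transitivity (\sum_(g <oo) (P (W @^-1` pre_max A g a) *
     (V b * P (W @^-1` F)))).
  apply: eq_eseriesr => g _.
  transitivity (\sum_(l <oo) P (W @^-1` D g l)).
    apply: measure_semi_bigcup => //.
    move=> l l' _ _ [w [h1 h2]].
    by have [] : g = g /\ l = l' by apply: trD; exists w.
  rewrite (eq_eseriesr (fun l _ => P_block g l ma mb mF)).
  have mpW : measurable (W @^-1` pre_max A g a).
    by apply: measurable_sampleW; exact: measurable_pre_max.
  rewrite (prE P mpW) (prE P (measurable_sampleW mF)) nneseriesZl//; last first.
    by move=> l _; rewrite mule_ge0// lee_fin pr_ge0.
  congr (_ * _); rewrite muleC -nneseriesZl//.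
  by apply: eq_eseriesr => l _; rewrite muleC.
rewrite /U (V_fin mb) (prE P (measurable_sampleW mF)) -EFinM [RHS]muleC
  -nneseriesZl//.
by apply: eq_eseriesr => g _; rewrite muleC.
Qed.

(** Full sets in [blocks_factor] give [U setT * V setT = 1], so that [U]
    and [V] are the laws of the rise and of the fall up to constants that
    cancel. *)
Lemma blocks_indep a b F : measurable a -> measurable b -> measurable F ->
  pr (W @^-1` (block_rise A @^-1` a `&` block_fall A @^-1` b `&`
    next_block A @^-1` F)) =
  (pr (W @^-1` (block_rise A @^-1` a)) * pr (W @^-1` (block_fall A @^-1` b)) *
   pr (W @^-1` F))%R.
Proof.
move=> ma mb mF.
have mT := @measurableT _ (rseq R); have mT' := @measurableT _ R.
have UV : U setT * V setT = 1.
  have := blocks_factor mT' mT' mT.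
  by rewrite !preimage_setT !setIT preimage_setT probability_setT mule1.
have Ua : P (W @^-1` (block_rise A @^-1` a)) = U a * V setT.
  have := blocks_factor ma mT' mT.
  by rewrite !preimage_setT !setIT probability_setT mule1.
have Vb : P (W @^-1` (block_fall A @^-1` b)) = U setT * V b.
  have := blocks_factor mT' mb mT.
  by rewrite !preimage_setT !setIT setTI probability_setT mule1.
have m1 : measurable (W @^-1` (block_rise A @^-1` a)).
  by apply: measurable_sampleW; apply: measurable_preimage => //;
    exact: measurable_block_rise.
have m2 : measurable (W @^-1` (block_fall A @^-1` b)).
  by apply: measurable_sampleW; apply: measurable_preimage => //;
    exact: measurable_block_fall.
have m3 : measurable (W @^-1` (next_block A @^-1` F)).
  by apply: measurable_sampleW; apply: measurable_preimage => //;
    exact: measurable_next.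
have m4 : measurable (W @^-1` (block_rise A @^-1` a `&` block_fall A @^-1` b `&`
    next_block A @^-1` F)).
  by rewrite !preimage_setI; apply: measurableI => //; exact: measurableI.
apply: EFin_inj; rewrite !EFinM -(prE P m1) -(prE P m2) -(prE P m4).
rewrite -(prE P (measurable_sampleW mF)) blocks_factor// Ua Vb.
have -> : U a * V setT * (U setT * V b) = U a * V b.
  by rewrite [U setT * _]muleC muleACA [V setT * _]muleC UV mule1.
by rewrite muleA.
Qed.

Local Close Scope ereal_scope.
Local Open Scope ring_scope.

Let AZ i (w : T) := rise_fall A i (W w).

Lemma measurable_rise_fall_sample : random_sequence AZ.
Proof.
move=> i; apply: (measurableT_comp (measurable_rise_fall mA i)).
exact: measurable_sample.
Qed.

Lemma prW_setT : pr (W @^-1` setT) = 1.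
Proof. by rewrite preimage_setT pr_setT. Qed.

(** What follows a block has the law of the whole sequence. *)
Lemma rise_fall_law i B : measurable B ->
  pr (AZ i @^-1` B) = pr (AZ (odd i) @^-1` B).
Proof.
move=> mB; elim/ltn_ind: i => -[|[|i]] IH //.
have mF : measurable (rise_fall A i @^-1` B).
  by apply: measurable_preimage => //; exact: measurable_rise_fall.
rewrite -[RHS]/(pr (AZ (odd i.+2) @^-1` B)) /= negbK -IH//.
have := blocks_indep measurableT measurableT mF.
rewrite !preimage_setT !setTI !prW_setT !mul1r => <-.
by congr pr; apply/seteqP; split => w /=; rewrite /AZ rise_fallSS.
Qed.

Lemma rise_fall_indep : indep_seq P AZ.
Proof.
move=> n; elim/ltn_ind: n => -[|[|n]] IH B mB.
- rewrite big_ord0 (_ : _ @^-1` _ = setT) ?pr_setT//.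
  by apply/seteqP; split.
- rewrite big_ord1; congr pr; apply/seteqP; split => w /=.
    by move=> /(_ 0%N isT).
  by move=> ? [].
pose F := [set y : rseq R | forall i, (i < n)%N -> B i.+2 (rise_fall A i y)].
have mF : measurable F.
  have := measurable_cyl n (fun i => mB i.+2).
  move/(measurable_preimage (f := fun y : rseq R => (fun i =>
    rise_fall A i y) : rseq R)).
  apply; apply: measurable_to_rseq => i; exact: measurable_rise_fall.
have -> : sample AZ @^-1` cyl n.+2 B =
    W @^-1` (block_rise A @^-1` B 0%N `&` block_fall A @^-1` B 1%N `&`
      next_block A @^-1` F).
  apply/seteqP; split => w /=.
    move=> h; split; first by split; [exact: (h 0%N)|exact: (h 1%N)].
    by move=> i ilt; have := h i.+2 ilt; rewrite /sample/= /AZ rise_fallSS.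
  move=> [[h0 h1] h2] [|[|i]] // ilt.
  by rewrite /sample /AZ rise_fallSS; exact: h2.
rewrite blocks_indep// big_ord_recl /= big_ord_recl /= mulrA; congr (_ * _).
rewrite -[W @^-1` F]/(sample AZ @^-1` cyl n (fun i => B i.+2)) IH//.
apply: eq_bigr => i _; rewrite rise_fall_law//.
by rewrite [RHS]rise_fall_law//= negbK.
Qed.

End DiscreteWienerHopf.

(** * Limits in probability of independent sequences *)

(** Replacing the factors of a product in [[0, 1]] one at a time costs at
    most [e] each. *)
Lemma ler_prod_perturb (R : realFieldType) n (a b : nat -> R) (e : R) :
  0 <= e -> (forall i, (i < n)%N -> 0 <= a i <= 1) ->
  (forall i, (i < n)%N -> 0 <= b i <= 1) ->
  (forall i, (i < n)%N -> a i <= b i + e) ->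
  \prod_(i < n) a i <= \prod_(i < n) b i + n%:R * e.
Proof.
move=> e0; elim: n => [|n IH] a01 b01 ab;
  first by rewrite !big_ord0 mul0r addr0.
rewrite !big_ord_recr /=.
have {}IH := IH (fun i h => a01 i (leqW h)) (fun i h => b01 i (leqW h))
  (fun i h => ab i (leqW h)).
have /andP[an0 an1] := a01 n (ltnSn n).
have /andP[bn0 bn1] := b01 n (ltnSn n).
have abn := ab n (ltnSn n).
have pa0 : 0 <= \prod_(i < n) a i.
  by apply: prodr_ge0 => i _; case/andP: (a01 i (leqW (ltn_ord i))).
have pa1 : \prod_(i < n) a i <= 1.
  by apply: prodr_ile1 => i _; exact: (a01 i (leqW (ltn_ord i))).
set A := \prod_(i < n) a i in IH pa0 pa1 *.
set B := \prod_(i < n) b i in IH *.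
have n0 : 0 <= n%:R :> R by [].
rewrite -natr1.
have h1 : A * a n <= A * b n + e.
  apply: (le_trans (ler_wpM2l pa0 abn)).
  by rewrite mulrDr lerD2l ler_piMl.
apply: (le_trans h1).
have h2 : A * b n <= B * b n + n%:R * e.
  apply: (le_trans (ler_wpM2r bn0 IH)).
  by rewrite mulrDl lerD2l ler_piMr// mulr_ge0.
lra.
Qed.

Section Limit.
Context (R : realType) (d : measure_display) (T : measurableType d)
  (P : probability T R).
Notation pr := (pr P).
Implicit Types Z : nat -> T -> R.

Definition below Z n (x : nat -> R) : set T :=
  [set w | forall i, (i < n)%N -> Z i w < x i].

Lemma belowE Z n x :
  below Z n x = sample Z @^-1` cyl n (fun i => `]-oo, x i[%classic).
Proof.
by apply/seteqP; split => w h i ilt; have := h i ilt; rewrite /= in_itv.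
Qed.

Lemma measurable_below Z n x : random_sequence Z -> measurable (below Z n x).
Proof.
move=> mZ; rewrite belowE; apply: measurable_preimage;
  first exact: measurable_sample.
exact: measurable_cyl.
Qed.

(** Finitely many strict inequalities leave some room below their bounds. *)
Lemma below_cvg Z n x : random_sequence Z ->
  pr (below Z n (fun i => x i - 2 * k.+1%:R^-1)) @[k --> \oo] -->
    pr (below Z n x).
Proof.
move=> mZ.
pose F k := below Z n (fun i => x i - 2 * k.+1%:R^-1).
have -> : below Z n x = \bigcup_k F k.
  apply/seteqP; split => w /=; last first.
    move=> [k _ h] i ilt; apply: (lt_le_trans (h i ilt)).
    by rewrite gerBl.
  move=> h.
  have [e e0 he] : exists2 e : R, 0 < e & forall i, (i < n)%N ->
    Z i w < x i - e.
    elim: n h {F} => [|n IH] h; first by exists 1.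
    have [e e0 he] := IH (fun i il => h i (leqW il)).
    have hn := h n (ltnSn n).
    exists (Num.min e ((x n - Z n w) / 2)).
      by rewrite lt_min e0 divr_gt0// subr_gt0.
    have m1 : Num.min e ((x n - Z n w) / 2) <= (x n - Z n w) / 2.
      by rewrite ge_min lexx orbT.
    have m2 : Num.min e ((x n - Z n w) / 2) <= e by rewrite ge_min lexx.
    move=> i ilt1; have [ilt|ni] := ltnP i n; first by have := he i ilt; lra.
    have -> : i = n by apply/eqP; rewrite eqn_leq ni andbT -ltnS.
    lra.
  have [k _ /(_ k (leqnn k)) hk] :=
    near_infty_natSinv_lt (PosNum (divr_gt0 e0 (ltr0Sn R 1))).
  exists k => // i ilt; have := he i ilt; move: hk => /=.
  set z := k.+1%:R^-1; lra.
apply: pr_cvg_up.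
  by move=> k; exact: measurable_below.
move=> k l kl; apply/subsetPset => w h i ilt; apply: (lt_le_trans (h i ilt)).
rewrite lerD2l lerN2 ler_pM2l// lef_pV2 ?posrE// ler_nat ltnS //.
Qed.

Definition far Z Z' n (e : R) : set T :=
  [set w | exists2 i, (i < n)%N & e <= `|Z' i w - Z i w|].

Lemma measurable_far Z Z' n e : random_sequence Z -> random_sequence Z' ->
  measurable (far Z Z' n e).
Proof.
move=> mZ mZ'.
rewrite (_ : far Z Z' n e = \bigcup_(i in [set i | (i < n)%N])
   ((fun w => e <= `|Z' i w - Z i w|) @^-1` [set true])).
  apply: bigcup_measurable => i _; apply: measurable_preimage => //.
  apply: measurable_fun_ler; first exact: measurable_cst.
  apply: measurableT_comp; first exact: normr_measurable.
  exact: measurable_funB.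
by apply/seteqP; split => w [i /= ilt h]; exists i.
Qed.

Lemma farC Z Z' n e : far Z Z' n e = far Z' Z n e.
Proof. by apply/seteqP; split => w [i ilt]; rewrite distrC; exists i. Qed.

Lemma pr_below_far Z Z' n x y (e : R) : random_sequence Z ->
  random_sequence Z' ->
  pr (far Z Z' n e) <= e -> (forall i, x i + e <= y i) ->
  pr (below Z n x) <= pr (below Z' n y) + e.
Proof.
move=> mZ mZ' fe xy.
have mf := measurable_far n e mZ mZ'.
have mx := measurable_below n x mZ; have my := measurable_below n y mZ'.
apply: (@le_trans _ _ (pr (below Z' n y `|` far Z Z' n e))).
  apply: le_pr => //; first exact: measurableU.
  move=> w wx; have [wf|nf] := pselect (far Z Z' n e w); first by right.
  left => i ilt; have := wx i ilt; have := xy i.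
  have : `|Z' i w - Z i w| < e.
    by rewrite ltNge; apply/negP => h; apply: nf; exists i.
  by rewrite ltr_norml => /andP[]; lra.
by apply: (le_trans (prU_le _ _ _)) => //; rewrite lerD2l.
Qed.

Lemma pr_below_le Z Z' n x y (e : R) : random_sequence Z ->
  random_sequence Z' ->
  pr (far Z Z' n e) <= e -> (forall i, x i + e <= y i) ->
  pr (below Z n x) <= pr (below Z' n y) + e /\
  pr (below Z' n x) <= pr (below Z n y) + e.
Proof.
move=> mZ mZ' fe xy; split; first exact: pr_below_far xy.
by apply: pr_below_far xy => //; rewrite farC.
Qed.

Lemma far_single Z Z' n i e : (i < n)%N -> random_sequence Z ->
  random_sequence Z' ->
  pr (far (fun=> Z i) (fun=> Z' i) 1 e) <= pr (far Z Z' n e).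
Proof.
move=> ilt mZ mZ'; apply: le_pr; try exact: measurable_far.
by move=> w [j _ h]; exists i.
Qed.

Lemma limit_squeeze (u v : R^nat) (a b c : R) :
  u k @[k --> \oo] --> a -> v k @[k --> \oo] --> b ->
  (forall k, u k <= b + c * k.+1%:R^-1) ->
  (forall k, v k <= a + c * k.+1%:R^-1) -> a = b.
Proof.
move=> ua vb ub va; apply/eqP; rewrite eq_le.
have c0 (x : R) : x + c * k.+1%:R^-1 @[k --> \oo] --> x.
  rewrite -[X in _ --> X]addr0; apply: cvgD; first exact: cvg_cst.
  rewrite -[X in _ --> X](mulr0 c); apply: cvgM; first exact: cvg_cst.
  exact: cvg_harmonic.
apply/andP; split.
  by apply: (ler_cvg_to ua (c0 b)); near=> k; exact: ub.
by apply: (ler_cvg_to vb (c0 a)); near=> k; exact: va.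
Unshelve. all: by end_near. Qed.

(** Together with independence, this says that the even terms are identically
    distributed, and so are the odd ones. *)
Definition alternating_law Z := forall i B, measurable B ->
  pr (Z i @^-1` B) = pr (Z (odd i) @^-1` B).

(** Approximation in probability of each initial segment; the approximating
    sequence depends on the segment and on the precision. *)
Definition approximable Z := forall n (e : R), 0 < e ->
  exists Z', [/\ random_sequence Z', indep_seq P Z', alternating_law Z' &
                 pr (far Z Z' n e) <= e].

Lemma below1 Z i (x : R) :
  below (fun=> Z i) 1 (fun=> x) = Z i @^-1` `]-oo, x[%classic.
Proof.
apply/seteqP; split => w /=; rewrite in_itv /=.
  by move=> /(_ 0%N isT).
by move=> h j _.
Qed.

(** Shifting a ray by [e] absorbs the error on the event that it is
    smaller than [e]; distribution functions written with strict inequalities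
    are left continuous, which removes the shift. *)
Lemma limit_law Z : random_sequence Z -> approximable Z -> alternating_law Z.
Proof.
move=> mZ apx i B mB.
rewrite -[Z i @^-1` B]setTI -[RHS]mul1r.
apply: (@pr_scale_unique _ _ _ P _ _ (@RGenInftyO.G R)
    (fun k => `]-oo, k%:R[%classic) (Z i) (Z (odd i)) setT 1) mB => //.
- exact: RGenInftyO.measurableE.
- move=> _ _ [x ->] [y ->]; exists (Num.min x y).
  by apply/seteqP; split => z /=; rewrite !in_itv /= lt_min => /andP.
- by move=> k; exists k%:R.
- apply/seteqP; split => // x _; exists (Num.truncn x).+1 => //=.
  by rewrite in_itv /= truncnS_gt.
move=> _ [x ->]; rewrite setTI mul1r -!below1.
have mc j : random_sequence (fun=> Z j) by move=> _; exact: mZ.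
pose x' (k : nat) := fun _ : nat => x - 2 * k.+1%:R^-1.
pose u j k := pr (below (fun=> Z j) 1 (x' k)).
have uc j : u j k @[k --> \oo] --> pr (below (fun=> Z j) 1 (fun=> x)).
  exact: (@below_cvg _ 1 (fun=> x) (mc j)).
have main j j' : odd j = odd j' -> forall k, u j k <=
    pr (below (fun=> Z j') 1 (fun=> x)) + 2 * k.+1%:R^-1.
  move=> jj' k; pose e := k.+1%:R^-1 : R.
  have e0 : 0 < e by rewrite invr_gt0.
  have [Z' [mZ' _ aZ' fZ']] := apx (j + j').+1 e e0.
  have jl : (j < (j + j').+1)%N by rewrite ltnS leq_addr.
  have jl' : (j' < (j + j').+1)%N by rewrite ltnS leq_addl.
  have mc' l : random_sequence (fun=> Z' l) by move=> _; exact: mZ'.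
  have [h1 _] := pr_below_le (x := x' k) (y := fun=> x - e) (mc j) (mc' j)
    (le_trans (far_single e jl mZ mZ') fZ')
    ltac:(by move=> ? /=; rewrite /x' -/e; lra).
  have [_ h2] := pr_below_le (x := fun=> x - e) (y := fun=> x) (mc j') (mc' j')
    (le_trans (far_single e jl' mZ mZ') fZ') ltac:(by move=> ? /=; lra).
  have : pr (below (fun=> Z' j) 1 (fun=> x - e)) =
    pr (below (fun=> Z' j') 1 (fun=> x - e)).
    by rewrite !below1 aZ'// jj' -aZ'.
  rewrite -/e /u; lra.
apply: (limit_squeeze (c := 2) (uc i) (uc (odd i))).
  by apply: main; rewrite oddb.
by apply: main; rewrite oddb.
Qed.

(** The argument of [limit_law] for joint distribution functions, the
    product being controlled by [ler_prod_perturb]. *)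
Lemma limit_indep Z : random_sequence Z -> approximable Z -> indep_seq P Z.
Proof.
move=> mZ apx; apply: indep_rays => // n x; rewrite -belowE.
have mc j : random_sequence (fun=> Z j) by move=> _; exact: mZ.
pose G j t := pr (below (fun=> Z j) 1 (fun=> t)).
rewrite (eq_bigr (fun i : 'I_n => G i (x i))); last by move=> i _;
  rewrite /G below1.
have G01 j t : 0 <= G j t <= 1.
  by rewrite pr_ge0 pr_le1//; exact: measurable_below.
have c1 := @below_cvg _ n x mZ.
have c2 : \prod_(i < n) G i (x i - 2 * k.+1%:R^-1) @[k --> \oo] -->
    \prod_(i < n) G i (x i).
  apply: cvg_big => //; first exact: mul_continuous.
  by move=> i _; exact: (@below_cvg _ 1 (fun=> x i) (mc i)).
apply: (limit_squeeze (c := n.+1%:R) c1 c2) => k; pose e := k.+1%:R^-1 : R.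
  have e0 : 0 < e by rewrite invr_gt0.
  have [Z' [mZ' iZ' _ fZ']] := apx n e e0.
  have mc' l : random_sequence (fun=> Z' l) by move=> _; exact: mZ'.
  have [h1 _] := pr_below_le (x := fun i => x i - 2 * k.+1%:R^-1)
    (y := fun i => x i - e) mZ mZ' fZ' ltac:(by move=> i /=; rewrite -/e; lra).
  apply: (le_trans h1); rewrite belowE iZ'//.
  rewrite -[n.+1%:R]natr1 mulrDl mul1r addrA lerD2r.
  apply: (@ler_prod_perturb _ n (fun i =>
    pr (Z' i @^-1` `]-oo, x i - e[%classic))
     (fun i => G i (x i)) e) => //.
  - exact: ltW.
  - move=> i _; rewrite pr_ge0 pr_le1//; exact: measurable_preimage.
  move=> i ilt; rewrite -below1.
  have [_ h2] := pr_below_le (x := fun=> x i - e) (y := fun=>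
    x i) (mc i) (mc' i)
    (le_trans (far_single e ilt mZ mZ') fZ') ltac:(by move=> ? /=; lra).
  exact: h2.
have e0 : 0 < e by rewrite invr_gt0.
have [Z' [mZ' iZ' _ fZ']] := apx n e e0.
have mc' l : random_sequence (fun=> Z' l) by move=> _; exact: mZ'.
have [_ h1] := pr_below_le (x := fun i => x i - e) (y := x)
  mZ mZ' fZ' ltac:(by move=> i /=; lra).
have h3 : \prod_(i < n) G i (x i - 2 * e) <= pr (below Z' n (fun i => x i - e))
    + n%:R * e.
  rewrite belowE iZ'//.
  apply: (@ler_prod_perturb _ n (fun i => G i (x i - 2 * e))
     (fun i => pr (Z' i @^-1` `]-oo, x i - e[%classic)) e) => //.
  - exact: ltW.
  - move=> i _; rewrite pr_ge0 pr_le1//; exact: measurable_preimage.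
  move=> i ilt; rewrite -below1.
  have [h2 _] := pr_below_le (x := fun=> x i - 2 * e) (y := fun=>
    x i - e) (mc i) (mc' i)
    (le_trans (far_single e ilt mZ mZ') fZ') ltac:(by move=> ? /=; lra).
  exact: h2.
rewrite -[n.+1%:R]natr1; move: h1 h3; rewrite -/e; lra.
Qed.

End Limit.

(** * Walks whose steps alternate between two laws *)

Section AlternatingWalks.
Context (R : realType) (d : measure_display) (T : measurableType d)
  (P : probability T R).
Notation pr := (pr P).

Definition pair_sum (y : rseq R) : rseq R := fun k => y k.*2 + y k.*2.+1.

Definition pair_walk (y : rseq R) : rseq R := psum (pair_sum y).

Lemma measurable_pair_sum : measurable_fun setT pair_sum.
Proof.
by apply: measurable_to_rseq => k; apply: measurable_funD;
  exact: measurable_coord.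
Qed.

Lemma measurable_pair_walk : measurable_fun setT pair_walk.
Proof.
apply: measurable_to_rseq => k.
by apply: (measurableT_comp (@measurable_psum R k)); exact: measurable_pair_sum.
Qed.

(** The first two terms are independent of the following ones, whose pair
    sums are again of the same kind. *)
Lemma pair_sum_indep Z : random_sequence Z -> indep_seq P Z ->
  indep_seq P (fun k w => pair_sum (sample Z w) k).
Proof.
move=> mZ iZ n; elim: n Z mZ iZ => [|n IH] Z mZ iZ B mB.
  by rewrite big_ord0 (_ : _ @^-1` _ = setT) ?pr_setT//; apply/seteqP; split.
pose E := [set y : rseq R | B 0%N (pair_sum y 0%N)].
pose F := pair_sum @^-1` cyl n (fun i => B i.+1).
have mE : measurable E.
  have m0 : measurable_fun setT (fun y => pair_sum y 0%N).
    by apply: (measurableT_comp (@measurable_coord R 0%N));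
      exact: measurable_pair_sum.
  exact: (measurable_preimage m0).
have mF : measurable F.
  by apply: measurable_preimage;
    [exact: measurable_pair_sum|exact: measurable_cyl].
have ES : sample Z @^-1` (seq_trunc 2 @^-1` E) =
    (fun w => pair_sum (sample Z w) 0%N) @^-1` B 0%N.
  by apply/seteqP; split.
have mZ2 : random_sequence (fun i => Z (2 + i)%N) by move=> i; exact: mZ.
have shE w k : pair_sum (sample (fun i => Z (2 + i)%N) w) k =
    pair_sum (sample Z w) k.+1.
  by rewrite /pair_sum /sample doubleS !add2n.
transitivity (pr (sample Z @^-1` (seq_trunc 2 @^-1` E) `&`
                  sample Z @^-1` (seq_shift 2 @^-1` F))).
  congr pr; rewrite ES; apply/seteqP; split => w /=.
    move=> h; split; first exact: (h 0%N).
    move=> i ilt; have := h i.+1 ilt; by rewrite /sample /= -shE.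
  move=> [h0 h1] [//|i] ilt; have := h1 i ilt.
  by rewrite -[seq_shift 2 _]/(sample (fun i => Z (2 + i)%N) w) shE.
rewrite indep_past_future// ES big_ord_recl; congr (_ * _).
have := IH _ mZ2 (shift_indep 2 mZ iZ) _ (fun i => mB i.+1).
rewrite -[sample Z @^-1` (seq_shift 2 @^-1` F)]/(sample (fun k w =>
  pair_sum (sample (fun i => Z (2 + i)%N) w) k) @^-1` cyl n (fun i =>
    B i.+1)) => ->.
by apply: eq_bigr => i _; congr (pr (_ @^-1` _)); apply/funext => w.
Qed.

Lemma pair_sum_ident Z : random_sequence Z -> indep_seq P Z ->
  (forall i B, measurable B -> pr (Z i.+2 @^-1` B) = pr (Z i @^-1` B)) ->
  forall n B, measurable B ->
  pr ((fun w => pair_sum (sample Z w) n) @^-1` B) =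
  pr ((fun w => pair_sum (sample Z w) 0%N) @^-1` B).
Proof.
move=> mZ iZ eZ n B mB.
have m0 : measurable_fun setT (fun y => pair_sum y 0%N).
  by apply: (measurableT_comp (@measurable_coord R 0%N));
    exact: measurable_pair_sum.
have mE := measurable_preimage m0 mB.
have eZ2 k i C : measurable C -> pr (Z (k.*2 + i)%N @^-1` C) = pr (Z i @^-1` C).
  by move=> mC; elim: k => [//|k IH]; rewrite doubleS !addSn eZ.
have mZ2 : random_sequence (fun i => Z (n.*2 + i)%N) by move=> i; exact: mZ.
have := indep_seq_law mZ2 mZ (shift_indep n.*2 mZ iZ) iZ (eZ2 n) mE.
rewrite (_ : sample (fun i => Z (n.*2 + i)%N) @^-1` _ =
  (fun w => pair_sum (sample Z w) n) @^-1` B)//.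
by apply/seteqP; split => w /=; rewrite /pair_sum /sample /= addn0 addn1.
Qed.

(** From [Z_0, Z_1, Z_2, ...] this makes [Z_2, Z_1, Z_4, Z_3, ...]. *)
Definition swap_index i := if odd i then i else i.+2.

Lemma swap_index_inj : injective swap_index.
Proof.
move=> i j; rewrite /swap_index.
case oi : (odd i); case oj : (odd j) => // e.
- by move: oi; rewrite e /= negbK oj.
- by move: oj; rewrite -e /= negbK oi.
- by case: e.
Qed.

Lemma pair_walk_opp (y : rseq R) n :
  pair_walk (fun i => - y i) n = - pair_walk y n.
Proof.
rewrite /pair_walk /psum -sumrN; apply: eq_bigr => i _.
by rewrite /pair_sum opprD.
Qed.

Context (Z : nat -> T -> R) (S S' : nat -> T -> R) (Y : T -> R).
Hypotheses (mZ : random_sequence Z) (iZ : indep_seq P Z)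
  (aZ : alternating_law P Z)
  (SE : forall n w, S n w = pair_walk (fun i => Z i.+1 w) n)
  (S'E : forall n w, S' n w = pair_walk (Z ^~ w) n)
  (YE : forall w, Y w = Z 0%N w).

Let Z1 := fun i => Z i.+1.

Let mZ1 : random_sequence Z1. Proof. by move=> i; exact: mZ. Qed.
Let iZ1 : indep_seq P Z1. Proof. exact: (shift_indep 1 mZ iZ). Qed.

Let SP : (fun w => S ^~ w) = pair_walk \o sample Z1.
Proof. by apply/funext => w; apply/funext => n; rewrite SE. Qed.
Let S'P : (fun w => S' ^~ w) = pair_walk \o sample Z.
Proof. by apply/funext => w; apply/funext => n; rewrite S'E. Qed.

Lemma random_sequence_S : random_sequence S.
Proof.
move=> n; rewrite (_ : S n = (fun y : rseq R =>
  y n) \o (pair_walk \o sample Z1)).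
  apply: (measurableT_comp (@measurable_coord R n)).
  by apply: (measurableT_comp measurable_pair_walk); exact: measurable_sample.
by apply/funext => w; rewrite /= SE.
Qed.

Lemma random_sequence_S' : random_sequence S'.
Proof.
move=> n; rewrite (_ : S' n = (fun y : rseq R =>
  y n) \o (pair_walk \o sample Z)).
  apply: (measurableT_comp (@measurable_coord R n)).
  by apply: (measurableT_comp measurable_pair_walk); exact: measurable_sample.
by apply/funext => w; rewrite /= S'E.
Qed.

Lemma S_increment n : (fun w => S n.+1 w - S n w) =
  (fun w => pair_sum (sample Z1 w) n).
Proof.
apply/funext => w; rewrite !SE /pair_walk /psum big_ord_recr /=.
by rewrite addrAC subrr add0r.
Qed.

Lemma alternating_random_walk : random_walk P S.
Proof.
split.
- exact: random_sequence_S.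
- by move=> w; rewrite SE /pair_walk psum0.
- rewrite (_ : (fun _ _ => _) = (fun n w => pair_sum (sample Z1 w) n));
  last first.
    by apply/funext => n; rewrite -S_increment.
  apply/mutually_independentP; last exact: pair_sum_indep.
  move=> n; rewrite -S_increment.
  by apply: measurable_funB; exact: random_sequence_S.
move=> n B mB.
have mi k : measurable ((fun w => pair_sum (sample Z1 w) k) @^-1` B).
  rewrite -S_increment; apply: measurable_preimage => //.
  by apply: measurable_funB; exact: random_sequence_S.
rewrite !S_increment !prE//; congr EFin; apply: pair_sum_ident => //.
by move=> i C mC; rewrite aZ// [RHS]aZ//= negbK.
Qed.

(** The steps of [S] are [Z_1 + Z_2, Z_3 + Z_4, ...].  Writing them
    [Z_2 + Z_1, Z_4 + Z_3, ...] shows the functional that gives [S'] from [Z],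
    applied to a reindexing of [Z] with the same law. *)
Lemma alternating_same_distribution : same_distribution P S S'.
Proof.
split; [exact: random_sequence_S|exact: random_sequence_S'|] => C mC.
have mC' : measurable (pair_walk @^-1` (C : set (rseq R))).
  by apply: measurable_preimage => //; exact: measurable_pair_walk.
pose Zs i := Z (swap_index i).
have mZs : random_sequence Zs by move=> i; exact: mZ.
have iZs : indep_seq P Zs by apply: indep_reindex => //; exact: swap_index_inj.
have eqw : sample Z1 @^-1` (pair_walk @^-1` C) =
  sample Zs @^-1` (pair_walk @^-1` C).
  have e w : pair_walk (sample Z1 w) = pair_walk (sample Zs w).
    apply/funext => n; apply: eq_bigr => k _.
    rewrite /pair_sum /sample /Z1 /Zs /swap_index /= odd_double /=.
    by rewrite addrC.
  by apply/seteqP; split => w; rewrite /preimage /mkset e.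
have -> : [set w | C (S ^~ w)] = sample Zs @^-1` (pair_walk @^-1` C).
  rewrite -eqw; apply/seteqP; split => w; rewrite /preimage /mkset;
    by have /(congr1 (@^~ w)) /= -> := SP.
have -> : [set w | C (S' ^~ w)] = sample Z @^-1` (pair_walk @^-1` C).
  apply/seteqP; split => w; rewrite /preimage /mkset;
    by have /(congr1 (@^~ w)) /= -> := S'P.
rewrite !prE; try (apply: measurable_preimage => //; exact: measurable_sample).
congr EFin; apply: indep_seq_law => // i B mB.
by rewrite /Zs /swap_index; case: (odd i) => //; rewrite aZ// [RHS]aZ//= negbK.
Qed.

(** The walk [S] only involves the terms after [Z_0]. *)
Lemma alternating_independent_of : independent_of P S Y.
Proof.
have YZ : Y = Z 0%N by apply/funext => w; rewrite YE.
split; [exact: random_sequence_S|by rewrite YZ|] => C B mC mB.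
have mC' : measurable (pair_walk @^-1` (C : set (rseq R))).
  by apply: measurable_preimage => //; exact: measurable_pair_walk.
have -> : [set w | C (S ^~ w)] =
  sample Z @^-1` (seq_shift 1 @^-1` (pair_walk @^-1` C)).
  apply/seteqP; split => w; rewrite /preimage /mkset;
    by have /(congr1 (@^~ w)) /= -> := SP.
pose E := [set y : rseq R | B (y 0%N)].
have mE : measurable E by exact: (measurable_preimage (@measurable_coord R
  0%N)).
have -> : Y @^-1` B = sample Z @^-1` (seq_trunc 1 @^-1` E).
  by rewrite YZ; apply/seteqP; split.
have mS : measurable (sample Z @^-1` (seq_shift 1 @^-1` (pair_walk @^-1` C))).
  apply: measurable_preimage; first exact: measurable_sample.
  by apply: measurable_preimage => //; exact: measurable_shift.
have mt : measurable (sample Z @^-1` (seq_trunc 1 @^-1` E)).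
  apply: measurable_preimage; first exact: measurable_sample.
  by apply: measurable_preimage => //; exact: measurable_trunc.
rewrite setIC !prE//; last exact: measurableI.
by rewrite -EFinM; congr EFin; rewrite indep_past_future// mulrC.
Qed.

End AlternatingWalks.

(** * Cadlag paths *)

Section Cadlag.
Context (R : realType) (x : R -> R) (cx : cadlag x).

Definition left_lim (t : R) : R := lim (x s @[s --> t^'-]).
Definition path_jump (t : R) : R := x t - left_lim t.

Lemma cadlag_right t e : 0 <= t -> 0 < e ->
  exists2 r, 0 < r & forall s, t <= s < t + r -> `|x s - x t| < e.
Proof.
move=> t0 e0; have [/(_ t t0) /cvgrPdist_lt /(_ e e0) [r /= r0 hr] _] := cx.
exists r => // s /andP[]; rewrite le_eqVlt => /predU1P[<- _|ts str].
  by rewrite subrr normr0.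
by rewrite distrC; apply: hr => //=; rewrite ltr_norml; lra.
Qed.

Lemma cadlag_left t e : 0 < t -> 0 < e ->
  exists2 r, 0 < r & forall s, t - r < s < t -> `|x s - left_lim t| < e.
Proof.
move=> t0 e0; have [_ /(_ t t0) ct] := cx.
have /cvgrPdist_lt /(_ e e0) [r /= r0 hr] := ct.
exists r => // s /andP[str st].
by rewrite distrC; apply: hr => //=; rewrite ltr_norml; lra.
Qed.

Lemma cadlag_local t e : 0 <= t -> 0 < e -> exists2 r, 0 < r &
  (forall s, t <= s < t + r -> `|x s - x t| < e) /\
  (forall s, 0 <= s -> t - r < s < t -> `|x s - left_lim t| < e).
Proof.
move=> t0 e0; have [r r0 hr] := cadlag_right t0 e0.
have [tE|tneq] := eqVneq t 0.
  by exists r => //; split => // s s0; rewrite tE => /andP[_]; lra.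
have tgt0 : 0 < t by rewrite lt_neqAle eq_sym tneq.
have [q q0 hq] := cadlag_left tgt0 e0.
have mr : Num.min r q <= r by rewrite ge_min lexx.
have mq : Num.min r q <= q by rewrite ge_min lexx orbT.
exists (Num.min r q); first by rewrite lt_min r0.
split => s; first by move=> ?; apply: hr; lra.
by move=> _ ?; apply: hq; lra.
Qed.

Lemma left_lim_dist t c e r : 0 < t -> 0 < r -> 0 <= e ->
  (forall s, 0 <= s -> t - r < s < t -> `|x s - c| <= e) ->
  `|left_lim t - c| <= e.
Proof.
move=> t0 r0 e0 h; apply/ler_addgt0Pr => d d0.
have [q q0 hq] := cadlag_left t0 d0.
pose m := Num.min (Num.min r q) t.
have m0 : 0 < m by rewrite !lt_min r0 q0.
have mr : m <= r by rewrite /m !ge_min lexx.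
have mq : m <= q by rewrite /m !ge_min lexx orbT.
have mt : m <= t by rewrite /m !ge_min lexx orbT.
pose s := t - m / 2.
have h1 : `|x s - c| <= e by apply: h; rewrite /s; lra.
have h2 : `|x s - left_lim t| < d by apply: hq; rewrite /s; lra.
rewrite (_ : left_lim t - c = (x s - c) - (x s - left_lim t)); last by ring.
by rewrite (le_trans (ler_normB _ _))// lerD// ltW.
Qed.

(** On either side of [u] the path varies little, and so do its left
    limits. *)
Lemma jumps_isolated u e : 0 <= u -> 0 < e -> exists2 r, 0 < r &
  forall t, 0 < t -> t != u -> `|t - u| < r -> `|path_jump t| <= e.
Proof.
move=> u0 e0; have e20 : 0 < e / 2 by rewrite divr_gt0.
have [r r0 [hr hl]] := cadlag_local u0 e20.
exists r => // t t0; rewrite neq_lt ltr_norml => /orP[tu|ut] trange.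
  have h1 : `|left_lim t - left_lim u| <= e / 2.
    apply: (@left_lim_dist t _ _ (r - (u - t))) => //; first 1 last.
    - exact: ltW.
    - by move=> s s0 sr; apply/ltW/hl => //; lra.
    - by lra.
  have h2 : `|x t - left_lim u| < e / 2 by apply: hl; lra.
  rewrite /path_jump (_ : x t - left_lim t =
    (x t - left_lim u) - (left_lim t - left_lim u)); last by ring.
  by rewrite (le_trans (ler_normB _ _))// [leRHS](splitr e) lerD// ltW.
have h1 : `|left_lim t - x u| <= e / 2.
  apply: (@left_lim_dist t _ _ (t - u)) => //; first 1 last.
  - exact: ltW.
  - by move=> s s0 sr; apply/ltW/hr => //; lra.
  - by rewrite subr_gt0.
have h2 : `|x t - x u| < e / 2 by apply: hr; lra.
rewrite /path_jump (_ : x t - left_lim t =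
  (x t - x u) - (left_lim t - x u)); last by ring.
by rewrite (le_trans (ler_normB _ _))// [leRHS](splitr e) lerD// ltW.
Qed.

(** Near each time [u] the path is close to its value at [u] on the right and
    to its left limit on the left, so a short interval either has a small
    increment or crosses some [u], and then its increment is close to the jump
    at [u].  Compactness of [[0, L]] makes the length uniform. *)
Lemma cadlag_modulus L e : 0 < e -> exists2 r, 0 < r &
  forall p q, 0 <= p -> p <= q -> q <= L -> q - p < r ->
    `|x q - x p| < e \/
    exists s, [/\ p < s, s <= q & `|x q - x p - path_jump s| < e].
Proof.
move=> e0; have e20 : 0 < e / 2 by rewrite divr_gt0.
pose Q (k : nat) p := forall q, 0 <= p -> p <= q -> q - p < k.+1%:R^-1 ->
    `|x q - x p| < e \/
    exists s, [/\ p < s, s <= q & `|x q - x p - path_jump s| < e].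
have /compact_near_coveringP cK := @segment_compact R 0 L.
have [|N _ /(_ N (leqnn N)) hN] := cK nat \oo Q _.
  move=> u; rewrite /= in_itv /= => /andP[u0 _].
  have [r r0 [hr hl]] := cadlag_local u0 e20.
  have r20 : 0 < r / 2 by rewrite divr_gt0.
  exists (ball u (r / 2), [set k | k.+1%:R^-1 < r / 2]) => /=.
    split; first exact: nbhsx_ballx.
    exact: (near_infty_natSinv_lt (PosNum r20)).
  move=> [p k] /= [+ kr] q p0 pq /lt_trans/(_ kr) qp {kr}.
  rewrite /ball/= ltr_norml => /andP[up1 up2].
  have pq3 (c : R) : `|x q - c| < e / 2 -> `|x p - c| < e / 2 ->
    `|x q - x p| < e.
    move=> h1 h2; rewrite (_ : x q - x p = (x q - c) - (x p - c)); last by ring.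
    by rewrite (le_lt_trans (ler_normB _ _))// [ltRHS](splitr e) ltrD.
  have [qu|uq] := ltP q u.
    by left; apply: (pq3 (left_lim u)); apply: hl => //; lra.
  have [up|pu] := leP u p.
    by left; apply: (pq3 (x u)); apply: hr; lra.
  right; exists u; split => //.
  have h1 : `|x q - x u| < e / 2 by apply: hr; lra.
  have h2 : `|x p - left_lim u| < e / 2 by apply: hl => //; lra.
  rewrite /path_jump (_ : _ - _ = (x q - x u) - (x p - left_lim u));
    last by ring.
  by rewrite (le_lt_trans (ler_normB _ _))// [ltRHS](splitr e) ltrD.
exists N.+1%:R^-1; first by rewrite invr_gt0.
move=> p q p0 pq qL qp; apply: hN => //.
by rewrite /= in_itv /= p0 (le_trans pq).
Qed.

Lemma cadlag_bounded L : exists M, forall p, 0 <= p <= L -> `|x p| <= M.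
Proof.
pose Q (k : nat) p := 0 <= p -> `|x p| <= k%:R.
have /compact_near_coveringP cK := @segment_compact R 0 L.
have [|N _ /(_ N (leqnn N)) hN] := cK nat \oo Q _.
  move=> u; rewrite /= in_itv /= => /andP[u0 _].
  have [r r0 [hr hl]] := cadlag_local u0 (@ltr01 R).
  pose B := Num.max `|x u| `|left_lim u| + 1.
  exists (ball u r, [set k : nat | B <= k%:R]) => /=.
    split; first exact: nbhsx_ballx.
    by exists (Num.truncn B).+1 => // k /= h;
      rewrite (le_trans (ltW (truncnS_gt B)))// ler_nat.
  move=> [p k] /= [+ kB] p0; rewrite /ball/= ltr_norml => /andP[up1 up2].
  apply: le_trans kB.
  have key c : `|c| <= Num.max `|x u| `|left_lim u| -> `|x p - c| < 1 ->
    `|x p| <= B.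
    move=> h1 h2; rewrite (_ : x p = c + (x p - c)); last by ring.
    by rewrite (le_trans (ler_normD _ _))// lerD// ltW.
  have [pu|up] := ltP p u.
    by apply: (key (left_lim u)); [rewrite le_max lexx orbT|apply: hl => //;
      lra].
  by apply: (key (x u)); [rewrite le_max lexx|apply: hr; lra].
by exists N%:R => p pL; apply: hN => //=; rewrite ?in_itv//=; case/andP: pL.
Qed.

End Cadlag.

(** * Dyadic grids *)

Section Grid.
Context (R : realType).
Implicit Types (m i : nat) (t e : R).

Definition mesh m : R := 2 ^- m.
Definition grid m i : R := i%:R * mesh m.
(** For nonnegative [t], the least [i] with [t <= grid m i]. *)
Definition gceil m t : nat := `|Num.ceil (t * 2 ^+ m)|%N.

Lemma mesh_gt0 m : 0 < mesh m.
Proof. by rewrite invr_gt0 exprn_gt0. Qed.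

Lemma mesh_small e : 0 < e -> \forall m \near \oo, mesh m < e.
Proof.
move=> e0; have : mesh m @[m --> \oo] --> (0 : R).
  rewrite /mesh; under eq_fun do rewrite -exprVn.
  by apply: cvg_expr; rewrite ger0_norm// invf_lt1// ltr1n.
by move=> /cvgr_lt; apply.
Qed.

Lemma grid0 m : grid m 0 = 0.
Proof. by rewrite /grid mul0r. Qed.

Lemma grid_ge0 m i : 0 <= grid m i.
Proof. by rewrite mulr_ge0// ltW// mesh_gt0. Qed.

Lemma gridS m i : grid m i.+1 = grid m i + mesh m.
Proof. by rewrite /grid -natr1 mulrDl mul1r. Qed.

Lemma ler_grid m i j : (grid m i <= grid m j) = (i <= j)%N.
Proof. by rewrite /grid ler_pM2r ?mesh_gt0// ler_nat. Qed.

Lemma ltr_grid m i j : (grid m i < grid m j) = (i < j)%N.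
Proof. by rewrite /grid ltr_pM2r ?mesh_gt0// ltr_nat. Qed.

Lemma grid_nat m a : grid m (a * 2 ^ m) = a%:R.
Proof.
by rewrite /grid /mesh natrM natrX -mulrA mulfV ?mulr1// expf_neq0.
Qed.

Lemma gceil_itv m t : 0 <= t ->
  t <= grid m (gceil m t) < t + mesh m.
Proof.
move=> t0.
have p0 : 0 < (2 : R) ^+ m by rewrite exprn_gt0.
have c0 : 0 <= Num.ceil (t * 2 ^+ m).
  by rewrite ceil_ge0 (lt_le_trans (ltrN10 R))// mulr_ge0// ltW.
have e : (gceil m t)%:R = (Num.ceil (t * 2 ^+ m))%:~R :> R.
  by rewrite /gceil natr_absz ger0_norm.
rewrite /grid e /mesh.
have /andP[h1 h2] := ceil_itv (t * 2 ^+ m).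
rewrite ler_pdivlMr// h2 /= ltr_pdivrMr// mulrDl mulVf ?gt_eqF//.
by rewrite -ltrBlDr; rewrite intrB in h1.
Qed.

Lemma gceil_le m t i : 0 <= t -> t <= grid m i -> (gceil m t <= i)%N.
Proof.
move=> t0 ti; have /andP[_ h] := gceil_itv m t0.
by rewrite -ltnS -(ltr_grid m) gridS (lt_le_trans h)// lerD2r.
Qed.

Lemma gceil_gt0 m t : 0 < t -> (0 < gceil m t)%N.
Proof.
move=> t0; have /andP[h _] := gceil_itv m (ltW t0).
by rewrite -(ltr_grid m) grid0 (lt_le_trans t0).
Qed.

Lemma gceil0 m : gceil m 0 = 0%N.
Proof. by rewrite /gceil mul0r ceil0. Qed.

Lemma gceil_pred m t : 0 < t -> grid m (gceil m t).-1 < t.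
Proof.
move=> t0; have /andP[_ h] := gceil_itv m (ltW t0).
by move: h; rewrite -[gceil m t]prednK ?gceil_gt0// gridS ltrD2r.
Qed.

End Grid.

(** * Large jumps and marked grid steps *)

Section Pathwise.
Context (R : realType) (d : measure_display) (T : measurableType d)
  (X : R -> T -> R) (eta1 eta2 : R).

Definition incr m : nat -> T -> R :=
  fun i w => X (grid R m i.+1) w - X (grid R m i) w.

(** The window is widened because the increments around a jump of size
    exactly [eta2] may exceed [eta2] slightly, and must not be marks. *)
Definition big_step p : set R :=
  ~` small_jumps (eta1 + p.+1%:R^-1) (eta2 + p.+1%:R^-1).

Definition big_jump w : set R :=
  [set t | 0 < t /\ (~` small_jumps eta1 eta2) (jump X t w)].

Context (w : T) (cX : cadlag (X ^~ w)) (eta1_gt0 : 0 < eta1)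
  (eta2_gt0 : 0 < eta2).

Lemma jumpE t : jump X t w = path_jump (X ^~ w) t.
Proof. by []. Qed.

(** The widening of the window absorbs the gap between the increment and
    the jump given by [cadlag_modulus]. *)
Lemma big_step_jump p L : exists2 r, 0 < r & forall m i,
  mesh R m < r -> grid R m i.+1 <= L -> big_step p (incr m i w) ->
  exists s, [/\ grid R m i < s, s <= grid R m i.+1 & big_jump w s].
Proof.
(* An increment below eta1 and eta2 in absolute value is not a mark, and a
   jump within 1 / (p + 1) of a mark is large. *)
pose e := Num.min p.+1%:R^-1 (Num.min eta1 eta2).
have e0 : 0 < e by rewrite !lt_min invr_gt0 eta1_gt0 eta2_gt0 ltr0Sn.
have ep : e <= p.+1%:R^-1 by rewrite /e ge_min lexx.
have ee1 : e <= eta1 by rewrite /e !ge_min lexx orbT.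
have ee2 : e <= eta2 by rewrite /e !ge_min lexx !orbT.
have [r r0 hr] := cadlag_modulus cX L e0.
exists r => // m i mr iL.
have di : grid R m i.+1 - grid R m i < r by rewrite gridS addrC addKr.
have li : grid R m i <= grid R m i.+1 by rewrite ler_grid.
have := hr (grid R m i) (grid R m i.+1) (grid_ge0 _ _ _) li iL di.
rewrite -/(incr m i w).
rewrite /big_step /small_jumps /=; set z := p.+1%:R^-1 in ep *.
have z0 : 0 < z by rewrite invr_gt0.
move=> [|[s [s1 s2]]]; rewrite ltr_norml => /andP[h1 h2] nI.
  by exfalso; apply: nI; apply/andP; split; lra.
exists s; split => //; split; first by rewrite (le_lt_trans _ s1)// grid_ge0.
move=> /= /andP[h3 h4]; apply: nI; rewrite jumpE in h3 h4.
by apply/andP; split; lra.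
Qed.

Lemma incr_cvg_jump s : 0 < s ->
  incr m (gceil m s).-1 w @[m --> \oo] --> jump X s w.
Proof.
move=> s0; apply/cvgrPdist_lt => e e0.
have e20 : 0 < e / 2 by rewrite divr_gt0.
have [r r0 hr] := cadlag_right cX (ltW s0) e20.
have [q q0 hq] := cadlag_left cX s0 e20.
near=> m.
have mr : mesh R m < r by near: m; exact: mesh_small.
have mq : mesh R m < q by near: m; exact: mesh_small.
have /andP[g1 g2] := gceil_itv m (ltW s0).
have g3 := gceil_pred m s0.
have gE : grid R m (gceil m s) = grid R m (gceil m s).-1 + mesh R m.
  by rewrite -gridS prednK// gceil_gt0.
have h1 : `|X (grid R m (gceil m s)) w - X s w| < e / 2 by apply: hr; lra.
have h2 : `|X (grid R m (gceil m s).-1) w - left_lim (X ^~ w) s| < e / 2.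
  by apply: hq; lra.
rewrite distrC /incr prednK ?gceil_gt0// jumpE /path_jump.
rewrite (_ : _ - _ = (X (grid R m (gceil m s)) w - X s w) -
  (X (grid R m (gceil m s).-1) w - left_lim (X ^~ w) s)); last by ring.
by rewrite (le_lt_trans (ler_normB _ _))// [ltRHS](splitr e) ltrD.
Unshelve. all: by end_near. Qed.

Lemma grid_cvg t : 0 <= t -> X (grid R m (gceil m t)) w @[m --> \oo] --> X t w.
Proof.
move=> t0; apply/cvgrPdist_lt => e e0.
have [r r0 hr] := cadlag_right cX t0 e0.
near=> m.
have mr : mesh R m < r by near: m; exact: mesh_small.
have /andP[g1 g2] := gceil_itv m t0.
by rewrite distrC; apply: hr; rewrite g1/= (lt_trans g2)// ltrD2l.
Unshelve. all: by end_near. Qed.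

(** The increment across [s] converges to the jump at [s], which is at a
    positive distance from the window. *)
Lemma jump_big_step s : big_jump w s -> exists p0, forall p, (p0 <= p)%N ->
  \forall m \near \oo, big_step p (incr m (gceil m s).-1 w).
Proof.
move=> [s0 hs]; set j := jump X s w in hs.
have [e e0 he] : exists2 e : R, 0 < e &
    forall y, `|y - j| < e -> y < - eta1 - e \/ eta2 + e < y.
  have [h|h] := ltP j (- eta1).
    exists ((- eta1 - j) / 2); first by rewrite divr_gt0// subr_gt0.
    by move=> y; rewrite ltr_norml => /andP[h1 h2]; left; lra.
  have h' : eta2 < j.
    by rewrite ltNge; apply/negP => h'; apply: hs; rewrite /small_jumps /= h.
  exists ((j - eta2) / 2); first by rewrite divr_gt0// subr_gt0.
  by move=> y; rewrite ltr_norml => /andP[h1 h2]; right; lra.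
have [p0 _ hp0] := near_infty_natSinv_lt (PosNum e0).
exists p0 => p /hp0 /= pe; have /cvgrPdist_lt /(_ e e0) := incr_cvg_jump s0.
apply: filterS => m; rewrite distrC -/j => /he;
  rewrite /big_step /small_jumps /=.
move: pe; set z := p.+1%:R^-1 => pe [h|h] /andP[]; lra.
Qed.

End Pathwise.

(** * Convergence of rises and falls along a path *)

Lemma leq_add_pred (a b n j : nat) : (j <= n)%N -> (n.+1 = b - a)%N ->
  (a + j <= b.-1)%N.
Proof. lia. Qed.

Lemma leq_sub_pred (a b n j : nat) : (a + j < b)%N -> (n.+1 = b - a)%N ->
  (j <= n)%N.
Proof. lia. Qed.

Lemma add_subS_pred (a b : nat) : (a < b)%N -> (a + (b - a).-1.+1 = b)%N.
Proof. lia. Qed.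

Lemma half_leq_bound (i n : nat) : (i < n)%N -> (i./2 <= n)%N.
Proof. lia. Qed.

Section Tau.
Context (R : realType) (d : measure_display) (T : measurableType d)
  (X : R -> T -> R) (eta1 eta2 : R).
Notation tau := (tau X eta1 eta2).

Lemma tau_leS n w : (tau n w <= tau n.+1 w)%E.
Proof.
by apply: le_ereal_inf_tmp => _ [t [/= h _] <-]; exact: ltW.
Qed.

Lemma tau_mono w : {homo tau ^~ w : m n / (m <= n)%N >-> (m <= n)%E}.
Proof. by apply: homo_leq => //; [exact: le_trans|move=> n; exact: tau_leS].
  Qed.

Lemma tau_ge0 n w : (0 <= tau n w)%E.
Proof. exact: (@tau_mono w 0%N n). Qed.

(** No jump has been removed before the first large one. *)
Lemma Xtilde_before_tau1 w :
  [set Xtilde X eta1 eta2 s w | s in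
     [set s : R | (0 <= s%:E < e_ X eta1 eta2 1 w)%E]] =
  [set X s w | s in [set s : R | (0 <= s%:E < tau 1 w)%E]].
Proof.
rewrite /e_ sube0.
have e s : (0 <= s%:E < tau 1 w)%E -> Xtilde X eta1 eta2 s w = X s w.
  move=> /andP[_ s1]; rewrite /Xtilde (_ : [set n | _] =
    set0) ?fsbig_set0 ?subr0//.
  apply/seteqP; split => // n /= [n1 ns].
  by have := lt_le_trans s1 (le_trans (tau_mono w n1) ns); rewrite ltxx.
by apply/seteqP; split => _ [s /= hs <-]; exists s => //; rewrite e.
Qed.

Lemma m0_M0 w : m0 X eta1 eta2 w = M_ X eta1 eta2 0 w.
Proof. by rewrite /m0 Xtilde_before_tau1. Qed.

Lemma i0_I0 w : i0 X eta1 eta2 w = I_ X eta1 eta2 0 w.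
Proof. by rewrite /i0 Xtilde_before_tau1. Qed.

Context (w : T) (cX : cadlag (X ^~ w)) (eta1_gt0 : 0 < eta1)
  (eta2_gt0 : 0 < eta2).
Notation bjump := (big_jump X eta1 eta2 w).

(** Large jumps are isolated, so the infimum that defines the next time is
    attained. *)
Lemma tau_next n a : tau n w = a%:E -> (exists2 t, a < t & bjump t) ->
  exists b, [/\ a < b, bjump b, tau n.+1 w = b%:E &
                forall t, a < t < b -> ~ bjump t].
Proof.
move=> na [t0 at0 bt0].
have a0 : 0 <= a by rewrite -lee_fin -na tau_ge0.
pose S := [set t | a < t /\ bjump t].
have SE : [set t : R | (tau n w < t%:E)%E /\
    (~` small_jumps eta1 eta2) (jump X t w)] = S.
  apply/seteqP; split => t /=; rewrite na lte_fin.
    by move=> [h1 h2]; split => //; split => //; exact: le_lt_trans h1.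
  by move=> [h1 [_ h2]].
have Si : has_inf S.
  by split; [exists t0|exists a => t [/ltW]].
pose b := inf S.
have ab : a <= b by apply: lb_le_inf; [exists t0|move=> t [/ltW]].
(* A jump of size at most e is not large. *)
pose e := Num.min eta1 eta2.
have e0 : 0 < e by rewrite lt_min eta1_gt0.
have [r r0 hr] := jumps_isolated cX (le_trans a0 ab) e0.
have Sb : S b.
  have [t [at_ bt] tb] := inf_adherent r0 Si.
  have bt' : b <= t by apply: ge_inf => //; exact: Si.2.
  have [<-//|tb'] := eqVneq t b.
  have : `|path_jump (X ^~ w) t| <= e.
    by apply: hr; rewrite ?bt.1// ltr_norml; lra.
  rewrite ler_norml => /andP[h1 h2]; exfalso; apply: bt.2.
  rewrite /small_jumps /= jumpE.
  have : e <= eta1 by rewrite ge_min lexx.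
  have : e <= eta2 by rewrite ge_min lexx orbT.
  by move=> ? ?; apply/andP; split; lra.
have [ab' bb] := Sb.
exists b; split => //.
  rewrite /= SE; apply/eqP; rewrite eq_le; apply/andP; split.
    by apply: ereal_inf_lbound; exists b.
  apply: le_ereal_inf_tmp => _ [t St <-]; rewrite lee_fin.
  by apply: ge_inf => //; exact: Si.2.
move=> t /andP[at_ tb] bt; have : b <= t by apply: ge_inf => //; exact: Si.2.
by rewrite leNgt tb.
Qed.

Definition unbounded_jumps := forall a, exists2 t, a < t & bjump t.

Hypothesis ub : unbounded_jumps.

Definition jump_time n : R := fine (tau n w).

Lemma tauE n : tau n w = (jump_time n)%:E.
Proof.
elim: n => [|n IH]; first by [].
by have [b [_ _ e _]] := tau_next IH (ub (jump_time n)); rewrite /jump_time e.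
Qed.

Lemma jump_time0 : jump_time 0 = 0. Proof. by []. Qed.

Lemma jump_time_ge0 n : 0 <= jump_time n.
Proof. by rewrite -lee_fin -tauE tau_ge0. Qed.

Lemma jump_time_step n : [/\ jump_time n < jump_time n.+1,
  bjump (jump_time n.+1) &
  forall t, jump_time n < t < jump_time n.+1 -> ~ bjump t].
Proof.
have [b [h1 h2 h3 h4]] := tau_next (tauE n) (ub (jump_time n)).
have -> : jump_time n.+1 = b by rewrite /jump_time h3.
by split.
Qed.

Lemma ShatE n : Shat X eta1 eta2 n w = X (jump_time n) w.
Proof. by []. Qed.

Lemma M_set n : [set t : R | (tau n w <= t%:E < tau n.+1 w)%E] =
  [set t | jump_time n <= t < jump_time n.+1].
Proof.
by apply/seteqP; split => t;
  rewrite /mkset (tauE n) (tauE n.+1) lee_fin lte_fin.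
Qed.

Lemma M_sup n : has_sup [set X t w | t in [set t | jump_time n <=
  t < jump_time n.+1]].
Proof.
split.
  exists (X (jump_time n) w), (jump_time n) => //=.
  by have [h _ _] := jump_time_step n; rewrite lexx.
have [K hK] := cadlag_bounded cX (jump_time n.+1).
exists K => _ [t /andP[h1 h2] <-].
rewrite (le_trans (ler_norm _))// hK// (le_trans (jump_time_ge0 n) h1)/=.
exact: ltW.
Qed.

Lemma M_ge n t : jump_time n <= t < jump_time n.+1 -> X t w <=
  M_ X eta1 eta2 n w.
Proof.
move=> h; rewrite /M_ M_set; apply: ub_le_sup; first by case: (M_sup n).
by exists t.
Qed.

Lemma M_adherent n e : 0 < e -> exists2 t, jump_time n <= t < jump_time n.+1 &
  M_ X eta1 eta2 n w - e < X t w.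
Proof.
move=> e0; rewrite /M_ M_set; have [_ [t ht <-] h] := sup_adherent e0 (M_sup n).
by exists t.
Qed.

Notation y m := (sample (incr X m) w).
Notation c m k := (gceil m (jump_time k)).

Lemma gceil_jump_time_lt k : \forall m \near \oo, (c m k < c m k.+1)%N.
Proof.
have [h _ _] := jump_time_step k.
near=> m.
have h1 : mesh R m < jump_time k.+1 - jump_time k.
  by near: m; apply: mesh_small; rewrite subr_gt0.
have /andP[_ h2] := gceil_itv m (jump_time_ge0 k).
have /andP[h3 _] := gceil_itv m (jump_time_ge0 k.+1).
rewrite -(ltr_grid R m); lra.
Unshelve. all: by end_near. Qed.

(** On the grid, the block that starts at the first grid point after
    [jump_time k] ends with the step that contains [jump_time k.+1]: that step
    is a mark by [jump_big_step], and an earlier mark would reveal a large jump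
    in between by [big_step_jump]. *)
Lemma block_tracked k : exists p0, forall p, (p0 <= p)%N ->
  \forall m \near \oo, (c m k < c m k.+1)%N /\
    first_mark (big_step eta1 eta2 p) (c m k.+1 - c m k).-1 (seq_shift (c m k)
      (y m)).
Proof.
have [tk bk nk] := jump_time_step k.
have [p0 hp0] := jump_big_step cX bk.
exists p0 => p /hp0 hm.
have [r r0 hr] := big_step_jump cX eta1_gt0 eta2_gt0 p (jump_time k.+1).
near=> m.
have ckk : (c m k < c m k.+1)%N by near: m; exact: gceil_jump_time_lt.
have mr : mesh R m < r by near: m; exact: mesh_small.
split => //; split.
  rewrite /seq_shift /sample.
  rewrite (_ : (_ + _)%N = (c m k.+1).-1); last by lia.
  by near: m.
move=> j jc bpj; set i := (c m k + j)%N.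
have iL : (i.+1 <= (c m k.+1).-1)%N by rewrite /i; lia.
have gi : grid R m i.+1 < jump_time k.+1.
  rewrite (le_lt_trans (y := grid R m (c m k.+1).-1)) ?ler_grid//.
  by apply: gceil_pred; exact: bk.1.
have [s [s1 s2 bs]] := hr m i mr (ltW gi) bpj.
apply: (nk s _ bs); rewrite (le_lt_trans s2 gi) andbT.
apply: le_lt_trans s1.
have /andP[h _] := gceil_itv m (jump_time_ge0 k).
by rewrite (le_trans h)// ler_grid leq_addr.
Unshelve. all: by end_near. Qed.

Lemma near_all_leq (Q : nat -> nat -> Prop) N :
  (forall k, \forall m \near \oo, Q k m) ->
  \forall m \near \oo, forall k, (k <= N)%N -> Q k m.
Proof.
move=> h; elim: N => [|N IH].
  by apply: filterS (h 0%N) => m h0 k; rewrite leqn0 => /eqP ->.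
apply: filterS2 IH (h N.+1) => m h1 h2 k.
by rewrite leq_eqVlt => /predU1P[->|/h1].
Qed.

Lemma blocks_tracked N : exists p0, forall p, (p0 <= p)%N ->
  \forall m \near \oo, forall k, (k <= N)%N -> (c m k < c m k.+1)%N /\
    first_mark (big_step eta1 eta2 p) (c m k.+1 - c m k).-1 (seq_shift (c m k)
      (y m)).
Proof.
elim: N => [|N [p0 h0]].
  have [p0 h0] := block_tracked 0; exists p0 => p /h0.
  by apply: filterS => m h k; rewrite leqn0 => /eqP ->.
have [p1 h1] := block_tracked N.+1; exists (maxn p0 p1) => p.
rewrite geq_max => /andP[/h0 + /h1]; apply: filterS2 => m {}h0 {}h1 k.
by rewrite leq_eqVlt => /predU1P[->|/h0].
Qed.

Lemma psum_incr m b j :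
  psum (seq_shift b (y m)) j = X (grid R m (b + j)) w - X (grid R m b) w.
Proof.
elim: j => [|j IH]; first by rewrite psum0 addn0 subrr.
rewrite /psum big_ord_recr /= -/(psum _ j) IH /seq_shift /sample /incr addnS.
by rewrite addrC addrA subrK.
Qed.

Lemma iter_next_tracked A m N :
  (forall k, (k < N)%N -> (c m k < c m k.+1)%N /\
    first_mark A (c m k.+1 - c m k).-1 (seq_shift (c m k) (y m))) ->
  iter N (next_block A) (y m) = seq_shift (c m N) (y m).
Proof.
elim: N => [|N IH] h.
  by rewrite jump_time0 gceil0; apply/funext => i; rewrite /seq_shift add0n.
rewrite iterS IH; last by move=> k kN; apply: h; exact: leqW.
have [h1 h2] := h N (ltnSn N).
rewrite /next_block (mark_indexE h2); apply/funext => i; rewrite /seq_shift;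
  congr sample.
by rewrite prednK ?subn_gt0// addnA subnKC// ltnW.
Qed.

(** The grid maximum is at most the supremum over the block; conversely a
    time where the supremum is nearly attained is approached from the right by
    grid points of the block. *)
Lemma block_max_cvg k e : 0 < e -> \forall m \near \oo,
  (c m k < c m k.+1)%N ->
  `|pmax (seq_shift (c m k) (y m)) (c m k.+1 - c m k).-1 + X (grid R m (c m k))
    w
    - M_ X eta1 eta2 k w| < e.
Proof.
move=> e0; have e20 : 0 < e / 2 by rewrite divr_gt0.
have [t /andP[t1 t2] Mt] := M_adherent k e20.
have t0 : 0 <= t := le_trans (jump_time_ge0 k) t1.
near=> m.
have mt : mesh R m < jump_time k.+1 - t.
  by near: m; apply: mesh_small; rewrite subr_gt0.
have Xt : `|X t w - X (grid R m (gceil m t)) w| < e / 2.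
  by near: m; move/cvgrPdist_lt : (grid_cvg cX t0); apply.
move=> ckk.
set z := seq_shift _ _; set n := _.-1.
have nE : (n.+1 = c m k.+1 - c m k)%N by rewrite /n prednK// subn_gt0.
have pE j : psum z j + X (grid R m (c m k)) w = X (grid R m (c m k + j)) w.
  by rewrite psum_incr subrK.
have [j jn jE] := pmax_attained z n; rewrite jE.
have [/andP[gk1 gk2] /andP[gk3 gk4] /andP[gt1 gt2]] :=
  And3 (gceil_itv m (jump_time_ge0 k)) (gceil_itv m (jump_time_ge0 k.+1))
    (gceil_itv m t0).
have t10 : 0 < jump_time k.+1 := le_lt_trans t0 t2.
have up : psum z j + X (grid R m (c m k)) w <= M_ X eta1 eta2 k w.
  rewrite pE; apply: M_ge; rewrite (le_trans gk1) ?ler_grid ?leq_addr//=.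
  apply: le_lt_trans (gceil_pred m t10).
  by rewrite ler_grid; exact: leq_add_pred nE.
suff lo : M_ X eta1 eta2 k w - e < psum z j + X (grid R m (c m k)) w.
  by rewrite ltr_norml; lra.
have [i iE] : exists i, (c m k + i)%N = gceil m t.
  exists (gceil m t - c m k)%N; rewrite subnKC//.
  by apply: gceil_le; [exact: jump_time_ge0|exact: le_trans gt1].
have ilt : (i <= n)%N.
  have : (gceil m t < c m k.+1)%N by rewrite -(ltr_grid R m); lra.
  by rewrite -iE => /leq_sub_pred; apply.
have := le_pmax z ilt; rewrite jE => zij.
have : X (grid R m (gceil m t)) w <= psum z j + X (grid R m (c m k)) w.
  by rewrite -iE -pE lerD2r.
move: Xt; rewrite ltr_norml; lra.
Unshelve. all: by end_near. Qed.

Definition path_rise_fall i (w : T) : R :=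
  if odd i then Shat X eta1 eta2 i./2.+1 w - M_ X eta1 eta2 i./2 w
  else M_ X eta1 eta2 i./2 w - Shat X eta1 eta2 i./2 w.

(** The threshold on [p] depends on the path, and that on [m] depends on
    [p] too: the window must first be narrow enough to mark all large jumps
    concerned, and the grid then fine enough for this window. *)
Lemma rise_fall_cvg n e : 0 < e -> exists p0, forall p, (p0 <= p)%N ->
  \forall m \near \oo, marked (big_step eta1 eta2 p) (y m) /\
    forall i, (i < n)%N -> `|rise_fall (big_step eta1 eta2 p) i (y m) -
      path_rise_fall i w| < e.
Proof.
move=> e0; have e20 : 0 < e / 2 by rewrite divr_gt0.
have [p0 hp] := blocks_tracked n.
exists p0 => p /hp hm {hp}.
near=> m.
have hb : forall k, (k <= n)%N -> (c m k < c m k.+1)%N /\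
    first_mark (big_step eta1 eta2 p) (c m k.+1 - c m k).-1 (seq_shift (c m k)
      (y m)).
  by near: m.
have hX : forall k, (k <= n)%N ->
    `|X (jump_time k) w - X (grid R m (c m k)) w| < e / 2.
  near: m; apply: near_all_leq => k.
  by move/cvgrPdist_lt : (grid_cvg cX (jump_time_ge0 k)); apply.
have hX' : forall k, (k <= n)%N ->
    `|X (jump_time k.+1) w - X (grid R m (c m k.+1)) w| < e / 2.
  near: m; apply: near_all_leq => k.
  by move/cvgrPdist_lt : (grid_cvg cX (jump_time_ge0 k.+1)); apply.
have hM : forall k, (k <= n)%N -> (c m k < c m k.+1)%N ->
  `|pmax (seq_shift (c m k) (y m)) (c m k.+1 - c m k).-1 + X (grid R m (c m k))
    w
    - M_ X eta1 eta2 k w| < e / 2.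
  by near: m; apply: near_all_leq => k; exact: block_max_cvg.
split.
  have [_ [h _]] := hb 0%N isT.
  by eexists; exact: h.
move=> i ilt; rewrite /rise_fall /path_rise_fall.
set k := i./2.
have kn : (k <= n)%N := half_leq_bound ilt.
have -> : iter k (next_block (big_step eta1 eta2 p)) (y m) =
  seq_shift (c m k) (y m).
  apply: iter_next_tracked => k' k'k; apply: hb.
  by rewrite (leq_trans _ kn)// ltnW.
have [ckk fm] := hb k kn.
have := hM k kn ckk; have := hX k kn; have := hX' k kn.
rewrite !ShatE /block_fall /block_rise (mark_indexE fm) psum_incr.
rewrite (add_subS_pred ckk).
rewrite !ltr_norml; case: (odd i); lra.
Unshelve. all: by end_near. Qed.

End Tau.

(** * Measurability *)

Lemma measurable_big_step (R : realType) (eta1 eta2 : R) p :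
  measurable (big_step eta1 eta2 p).
Proof.
apply: measurableC.
rewrite (_ : small_jumps _ _ = `[- (eta1 + p.+1%:R^-1),
  eta2 + p.+1%:R^-1]%classic).
  exact: measurable_itv.
by apply/seteqP; split => x; rewrite /small_jumps /= in_itv.
Qed.

Lemma measurable_le_fun d (T : measurableType d) (R : realType) (f : T -> R) :
  (forall a, measurable [set w | f w <= a]) -> measurable_fun setT f.
Proof.
move=> h; apply: (measurability (@RGenOInfty.G R)).
  exact: RGenOInfty.measurableE.
move=> _ [_ [a ->] <-]; rewrite setTI.
rewrite (_ : _ @^-1` _ = ~` [set w | f w <= a]); first exact: measurableC.
by apply/seteqP; split => w /=; rewrite in_itv /= andbT ltNge => /negP.
Qed.

Lemma measurable_lt_efun d (T : measurableType d) (R : realType)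
    (f : T -> \bar R) :
  (forall a : R, measurable [set w | (f w < a%:E)%E]) -> measurable_fun setT f.
Proof.
move=> h; apply: (measurability (@ErealGenInftyO.G R)).
  exact: ErealGenInftyO.measurableE.
move=> _ [_ [a ->] <-]; rewrite setTI.
by rewrite (_ : _ @^-1` _ = [set w | (f w < a%:E)%E]).
Qed.

Section Measurability.
Context (R : realType) (d : measure_display) (T : measurableType d)
  (X : R -> T -> R) (eta1 eta2 : R).
Hypotheses (mX : forall t, 0 <= t -> measurable_fun setT (X t))
  (cX : forall w, cadlag (X ^~ w)) (eta1_gt0 : 0 < eta1) (eta2_gt0 : 0 < eta2).
Notation bjump := (big_jump X eta1 eta2).
Notation tau := (tau X eta1 eta2).

Lemma measurable_incr m : random_sequence (incr X m).
Proof. by move=> i; apply: measurable_funB; apply: mX; exact: grid_ge0. Qed.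

Definition jump_in a b w := exists s, [/\ a < s, s < b & bjump w s].

Definition marked_in a b p m : set T :=
  [set w | exists i, [/\ a <= grid R m i, grid R m i.+1 < b &
     big_step eta1 eta2 p (incr X m i w)]].

(** Large jumps in an open interval are seen by all fine grids, which makes
    their occurrence an event. *)
Lemma jump_inP a b w : 0 <= a -> jump_in a b w <->
  exists p m0, forall m, (m0 <= m)%N -> marked_in a b p m w.
Proof.
move=> a0; split.
  move=> [s [as_ sb bs]]; have [p0 /(_ p0 (leqnn p0)) hp] :=
    jump_big_step (cX w) bs.
  have s0 := bs.1.
  have : \forall m \near \oo, marked_in a b p0 m w.
    near=> m; exists (gceil m s).-1; rewrite prednK ?gceil_gt0//.
    have m1 : mesh R m < s - a.
      by near: m; apply: mesh_small; rewrite subr_gt0.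
    have m2 : mesh R m < b - s.
      by near: m; apply: mesh_small; rewrite subr_gt0.
    have /andP[h1 h2] := gceil_itv m (ltW s0).
    have := gridS R m (gceil m s).-1; rewrite prednK ?gceil_gt0// => e.
    by split; [lra|lra|near: m].
  by move=> [m0 _ h]; exists p0, m0.
move=> [p [m0 h]].
have [r r0 hr] := big_step_jump (cX w) eta1_gt0 eta2_gt0 p b.
have [m1 _ /(_ (maxn m0 m1)) hm1] := mesh_small r0.
have [i [h1 h2 h3]] := h (maxn m0 m1) (leq_maxl _ _).
have [s [s1 s2 bs]] := hr _ i (hm1 (leq_maxr _ _)) (ltW h2) h3.
exists s; split => //; first exact: le_lt_trans s1.
exact: le_lt_trans h2.
Unshelve. all: by end_near. Qed.

Lemma measurable_marked_in a b p m : measurable (marked_in a b p m).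
Proof.
rewrite (_ : marked_in _ _ _ _ = \bigcup_(i in [set i | a <= grid R m i /\
    grid R m i.+1 < b]) (incr X m i @^-1` big_step eta1 eta2 p)).
  apply: bigcup_measurable => i _; apply: measurable_preimage;
    first exact: measurable_incr.
  exact: measurable_big_step.
apply/seteqP; split => w /=.
  by move=> [i [h1 h2 h3]]; exists i.
by move=> [i [h1 h2] h3]; exists i.
Qed.

Lemma measurable_jump_in a b : 0 <= a -> measurable [set w | jump_in a b w].
Proof.
move=> a0; rewrite (_ : [set w | _] =
  \bigcup_p \bigcup_m0 \bigcap_(m in [set m | (m0 <= m)%N]) marked_in a b p m).
  apply: bigcupT_measurable => p; apply: bigcupT_measurable => m0.
  apply: bigcap_measurable; first by exists m0 => /=.
  by move=> m _; exact: measurable_marked_in.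
apply/seteqP; split => w /=.
  by move=> /(jump_inP _ _ a0)[p [m0 h]]; exists p => //; exists m0.
move=> [p _ [m0 _ h]]; apply/(jump_inP _ _ a0); exists p, m0.
by move=> m /h.
Qed.

(** The time [tau n.+1] is before [a] when some grid point after [tau n] is
    followed by a large jump before [a]. *)
Lemma measurable_tau n : measurable_fun setT (tau n).
Proof.
elim: n => [|n IH]; first exact: measurable_cst.
apply: measurable_lt_efun => a.
rewrite (_ : [set w | _] =
  \bigcup_m \bigcup_i ([set w | (tau n w < (grid R m i)%:E)%E]
   `&` [set w | jump_in (grid R m i) a w])).
  apply: bigcupT_measurable => m; apply: bigcupT_measurable => i.
  apply: measurableI; last by apply: measurable_jump_in; exact: grid_ge0.
  by rewrite -[X in measurable X]setTI; exact: emeasurable_fun_infty_o.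
apply/seteqP; split => w /=.
  move=> /ereal_inf_lt[_ [s [ts js] <-]]; rewrite lte_fin => sa.
  have [b bE] : exists b, tau n w = b%:E.
    move: ts (tau_ge0 X eta1 eta2 n w); case: (tau n w) => [b| |] // _ _.
    by exists b.
  move: ts; rewrite bE lte_fin => bs.
  have b0 : 0 <= b by rewrite -lee_fin -bE tau_ge0.
  have s0 := le_lt_trans b0 bs.
  have [m _ /(_ m (leqnn m)) ms] :=
    @mesh_small R (s - b) ltac:(by rewrite subr_gt0).
  have gp := gceil_pred m s0.
  exists m => //; exists (gceil m s).-1 => //; split.
    rewrite /mkset bE lte_fin; have /andP[h1 h2] := gceil_itv m (ltW s0).
    have := gridS R m (gceil m s).-1; rewrite prednK ?gceil_gt0// => e.
    lra.
  by exists s; split.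
move=> [m _ [i _ [/= ti [s [is_ sa [s0 js]]]]]].
apply: (@le_lt_trans _ _ s%:E); last by rewrite lte_fin.
apply: ereal_inf_lbound; exists s => //; split => //.
by apply: (lt_trans ti); rewrite lte_fin.
Qed.

Lemma measurable_jump_time n : measurable_fun setT (fun w => fine (tau n w)).
Proof. by apply: (measurableT_comp (fine_measurable measurableT));
  exact: measurable_tau. Qed.

Lemma fine_tau_ge0 n w : 0 <= fine (tau n w).
Proof. by apply: fine_ge0; exact: tau_ge0. Qed.

(** By right continuity the value at a random time is the limit of the
    values at the next grid points. *)
Lemma measurable_Shat n : measurable_fun setT (Shat X eta1 eta2 n).
Proof.
pose c m w := gceil m (fine (tau n w)).
apply: (measurable_fun_cvg (h := fun m w => X (grid R m (c m w)) w));
  last first.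
  by move=> w _; apply: grid_cvg => //; exact: fine_tau_ge0.
move=> m; apply: (measurable_fun_select (f := fun i => X (grid R m i))).
  by move=> i; apply: mX; exact: grid_ge0.
have mle i : measurable [set w | (c m w <= i)%N].
  rewrite (_ : [set w | _] = [set w | fine (tau n w) <= grid R m i]).
    rewrite -[X in measurable X]setTI (_ : _ `&` _ =
       setT `&` (fun w => fine (tau n w) <= grid R m i) @^-1` [set true]).
      apply: measurable_fun_ler => //; first exact: measurable_jump_time.
    by apply/seteqP; split => w [_ h].
  apply/seteqP; split => w /=.
    move=> ci; have /andP[h _] := gceil_itv m (fine_tau_ge0 n w).
    by rewrite (le_trans h)// ler_grid.
  by move=> ?; apply: gceil_le => //; exact: fine_tau_ge0.
case=> [|i].
  rewrite (_ : _ @^-1` _ = [set w | (c m w <= 0)%N])//.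
  by apply/seteqP; split => w /=; rewrite leqn0 => /eqP.
rewrite (_ : _ @^-1` _ = [set w | (c m w <= i.+1)%N] `\` [set w | (c m w <=
  i)%N]).
  exact: measurableD.
apply/seteqP; split => w /=; first by move=> ->; rewrite ltnn.
by move=> [h1 /negP h2]; apply/eqP; rewrite eqn_leq h1 ltnNge.
Qed.

(** By right continuity the upper bounds of the path over the block are
    those of its values at the grid points of the block.  The supremum is 0 by
    convention when there is no bound or no point, hence the event [H] where it
    is a genuine one. *)
Lemma measurable_M n : measurable_fun setT (M_ X eta1 eta2 n).
Proof.
pose K m i : set T := [set w | (tau n w <= (grid R m i)%:E < tau n.+1 w)%E].
have mK m i : measurable (K m i).
  rewrite (_ : K m i = [set w | (tau n w <= (grid R m i)%:E)%E] `&`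
                       [set w | ((grid R m i)%:E < tau n.+1 w)%E]).
    apply: measurableI; rewrite -[X in measurable X]setTI.
      by apply: emeasurable_fun_infty_c => //; exact: measurable_tau.
    by apply: emeasurable_fun_o_infty => //; exact: measurable_tau.
  by apply/seteqP; split => w /=; [move=> /andP|move=> ?; apply/andP].
pose Ub c : set T := \bigcap_m \bigcap_i (~` K m i `|` [set w | X (grid R m i)
  w <= c]).
have mUb c : measurable (Ub c).
  apply: bigcapT_measurable => m; apply: bigcapT_measurable => i.
  apply: measurableU; first exact: measurableC.
  rewrite (_ : [set w | _] = X (grid R m i) @^-1` `]-oo, c]%classic).
    by apply: measurable_preimage => //; apply: mX; exact: grid_ge0.
  by apply/seteqP; split => w; rewrite /= in_itv.
pose S w := [set X t w | t in [set t : R | (tau n w <= t%:E < tau n.+1 w)%E]].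
have approx w t : (tau n w <= t%:E < tau n.+1 w)%E ->
    0 <= t /\ \forall m \near \oo, K m (gceil m t) w.
  move=> /andP[h1 h2].
  have t0 : 0 <= t by rewrite -lee_fin (le_trans _ h1)// tau_ge0.
  split => //.
  have [e e0 he] : exists2 e : R, 0 < e & ((t + e)%:E <= tau n.+1 w)%E.
    move: h2; case: (tau n.+1 w) => [b| |] //.
      by rewrite lte_fin => tb; exists (b - t); rewrite ?subr_gt0// lee_fin;
        lra.
    by move=> _; exists 1 => //; rewrite leey.
  near=> m; have me : mesh R m < e by near: m; exact: mesh_small.
  have /andP[h3 h4] := gceil_itv m t0.
  apply/andP; split; first by rewrite (le_trans h1)// lee_fin.
  by rewrite (lt_le_trans _ he)// lte_fin; lra.
have ubP w c : Ub c w <-> ubound (S w) c.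
  split; last first.
    move=> h m _ i _; have [Kw|nK] := pselect (K m i w); last by left.
    by right; apply: h; exists (grid R m i).
  move=> h _ [t ht <-]; have [t0 ht'] := approx w t ht.
  apply: (ler_cvg_to (grid_cvg (cX w) t0) (cvg_cst c)).
  by apply: filterS ht' => m Km; case: (h m I (gceil m t) I).
pose B := \bigcup_m \bigcup_i K m i.
have mB : measurable B.
  by apply: bigcupT_measurable => m; apply: bigcupT_measurable => i.
have BP w : B w <-> (S w) !=set0.
  split; first by move=> [m _ [i _ Kw]];
    exists (X (grid R m i) w), (grid R m i).
  move=> [_ [t ht _]]; have [_ [m _ /(_ m (leqnn m)) h]] := approx w t ht.
  by exists m => //; exists (gceil m t).
pose H := B `&` \bigcup_(k : nat) Ub k%:R.
have mH : measurable H.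
  by apply: measurableI => //; apply: bigcupT_measurable => k; exact: mUb.
have HP w : H w <-> has_sup (S w).
  split; first by move=> [/BP h1 [k _ /ubP h2]]; split => //; exists k%:R.
  move=> [/BP h1 [c hc]]; split => //.
  exists (Num.truncn c).+1 => //; apply/ubP => z Sz.
  by rewrite (le_trans (hc z Sz))// ltW// truncnS_gt.
apply: measurable_le_fun => a.
rewrite (_ : [set w | _] = (H `&` Ub a) `|` (~` H `&` (if 0 <=
  a then setT else set0))).
  apply: measurableU; first exact: measurableI.
  by apply: measurableI; [exact: measurableC|case: ifP].
apply/seteqP; split => w /=.
  move=> Ma; have [Hw|nH] := pselect (H w).
    left; split => //; apply/ubP => z Sz; apply: le_trans Ma.
    by apply: ub_le_sup => //; have [] := (HP w).1 Hw.
  right; split => //; move: Ma; rewrite /M_ sup_out; first by move=> ->.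
  by move=> /HP.
move=> [[Hw /ubP ub]|[nH]].
  by apply: ge_sup => //; have [] := (HP w).1 Hw.
by case: ifP => // a0 _; rewrite /M_ sup_out// => /HP.
Unshelve. all: by end_near. Qed.

Lemma measurable_path_rise_fall : random_sequence (path_rise_fall X eta1 eta2).
Proof.
by move=> i; rewrite /path_rise_fall; case: (odd i); apply: measurable_funB;
  (exact: measurable_M || exact: measurable_Shat).
Qed.

End Measurability.

(** * Almost sure tracking and independence of rises and falls *)

Section Core.
Context (R : realType) (d : measure_display) (T : measurableType d)
  (P : probability T R) (X : R -> T -> R) (eta1 eta2 : R).
Notation pr := (pr P).
Hypotheses (mX : forall t, 0 <= t -> measurable_fun setT (X t))
  (X0 : forall w, X 0 w = 0)
  (cX : forall w, cadlag (X ^~ w)) (eta1_gt0 : 0 < eta1) (eta2_gt0 : 0 < eta2)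
  (iX : forall m, indep_seq P (incr X m))
  (eX : forall m i B, measurable B ->
     pr (incr X m i @^-1` B) = pr (incr X m 0%N @^-1` B)).
Notation bjump := (big_jump X eta1 eta2).
Notation big_step := (big_step eta1 eta2).

Definition marked_unit p m : set T :=
  [set w | exists2 i, (i < 2 ^ m)%N & big_step p (incr X m i w)].

Lemma measurable_marked_unit p m : measurable (marked_unit p m).
Proof.
rewrite (_ : marked_unit p m = \bigcup_(i in [set i | (i < 2 ^ m)%N])
   (incr X m i @^-1` big_step p)).
  apply: bigcup_measurable => i _; apply: measurable_preimage;
    first exact: measurable_incr.
  exact: measurable_big_step.
by apply/seteqP; split => w [i h1 h2]; exists i.
Qed.

Definition often_marked p : set T :=
  \bigcup_k \bigcap_(m in [set m | (k <= m)%N]) marked_unit p m.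

Lemma measurable_often_marked p : measurable (often_marked p).
Proof. by apply: measurable_liminf => m; exact: measurable_marked_unit. Qed.

(** A large jump in the first unit of time, its end included, falls in one
    of the first [2 ^ m] steps. *)
Lemma unit_jump_often_marked w s : s <= 1 -> bjump w s ->
  (\bigcup_p often_marked p) w.
Proof.
move=> s1 bs; have [p0 /(_ p0 (leqnn p0)) [m0 _ h]] := jump_big_step (cX w) bs.
exists p0 => //; exists m0 => // m /h hm; exists (gceil m s).-1 => //.
rewrite prednK ?gceil_gt0 ?bs.1//; apply: gceil_le; first exact/ltW/bs.1.
by rewrite -[(2 ^ m)%N]mul1n grid_nat.
Qed.

(** A run of [L * 2 ^ m] steps is made of [L] independent copies of the steps
    in the first unit of time. *)
Lemma pr_no_mark p m a L :
  pr (\bigcap_(i in [set i | (i < L * 2 ^ m)%N])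
       (incr X m (a * 2 ^ m + i)%N @^-1` (~` big_step p))) =
  (1 - pr (marked_unit p m)) ^+ L.
Proof.
have mb := measurable_big_step eta1 eta2 p.
have mi := measurable_incr mX m.
pose q := pr (incr X m 0%N @^-1` (~` big_step p)).
have main b n : pr (\bigcap_(i in [set i | (i < n)%N])
       (incr X m (b + i)%N @^-1` (~` big_step p))) = q ^+ n.
  have sI := shift_indep b mi (iX m).
  have := sI n (fun=> ~` big_step p) (fun=> measurableC mb).
  rewrite (_ : sample _ @^-1` _ = \bigcap_(i in [set i | (i < n)%N])
       (incr X m (b + i)%N @^-1` (~` big_step p))) => [->|]; last first.
    by apply/seteqP; split => w h i ilt; exact: h.
  rewrite (eq_bigr (fun=> q)) ?prodr_const ?card_ord// => i _.
  by rewrite eX//; exact: measurableC.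
rewrite main mulnC exprM; congr (_ ^+ L).
rewrite -prC; last exact: measurable_marked_unit.
rewrite -(main 0%N); congr pr; apply/seteqP; split => w /=.
  by move=> h [i ilt bi]; exact: (h i ilt).
by move=> h i ilt bi; apply: h; exists i.
Qed.

Definition no_jump_after a : set T := \bigcap_(b : nat)
  ~` [set w | jump_in X eta1 eta2 a b%:R w].

Lemma measurable_no_jump_after (a : nat) : measurable (no_jump_after a%:R).
Proof.
apply: bigcapT_measurable => b; apply: measurableC.
exact: measurable_jump_in.
Qed.

Lemma no_jump_after_unmarked p a L w : no_jump_after a%:R w ->
  \forall m \near \oo, (\bigcap_(i in [set i | (i < L * 2 ^ m)%N])
       (incr X m (a * 2 ^ m + i)%N @^-1` (~` big_step p))) w.
Proof.
move=> nj; have [r r0 hr] :=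
  big_step_jump (cX w) eta1_gt0 eta2_gt0 p (a + L)%N%:R.
apply: filterS (mesh_small r0) => m mr i /= il bi.
have iL : grid R m (a * 2 ^ m + i).+1 <= (a + L)%N%:R.
  by rewrite -(grid_nat _ m) ler_grid mulnDl -addnS leq_add2l.
have [s [s1 s2 bs]] := hr m _ mr iL bi.
apply: (nj (a + L).+1 I); exists s; split => //.
  by apply: le_lt_trans s1; rewrite -(grid_nat _ m) ler_grid leq_addr.
by rewrite (le_lt_trans s2)// (le_lt_trans iL)// ltr_nat.
Qed.

(** Some widening [p] and some [c > 0] are such that on all fine grids the
    first unit of time contains a mark with probability at least [c].  The
    absence of large jumps after [a] excludes marks during the next [L] units
    on fine grids, which has probability at most [(1 - c) ^+ L]. *)
Lemma pr_no_jump_after (a : nat) : 0 < pr (\bigcup_p often_marked p) ->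
  pr (no_jump_after a%:R) = 0.
Proof.
move=> /pr_bigcup_gt0 [|p p0]; first exact: measurable_often_marked.
pose c := pr (often_marked p) / 2.
have c0 : 0 < c by rewrite divr_gt0.
have cl : c < pr (often_marked p) by rewrite /c ltr_pdivrMr// ltr_pMr// ltr1n.
have [k hk] := pr_liminf_ex (measurable_marked_unit p) cl.
have c1 : c < 1.
  by rewrite (lt_le_trans cl)// pr_le1//; exact: measurable_often_marked.
pose N L m := \bigcap_(i in [set i | (i < L * 2 ^ m)%N])
       (incr X m (a * 2 ^ m + i)%N @^-1` (~` big_step p)).
have mN L m : measurable (N L m).
  rewrite (_ : N L m = ~` \bigcup_(i in [set i | (i < L * 2 ^ m)%N])
       (incr X m (a * 2 ^ m + i)%N @^-1` big_step p)).
    apply: measurableC; apply: bigcup_measurable => i _;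
      apply: measurable_preimage.
      exact: measurable_incr.
    exact: measurable_big_step.
  by rewrite setC_bigcup.
have bound L : pr (no_jump_after a%:R) <= (1 - c) ^+ L.
  rewrite leNgt; apply/negP => h.
  have mnj := measurable_no_jump_after a.
  have : (1 - c) ^+ L < pr (\bigcup_k \bigcap_(m in [set m | (k <=
    m)%N]) N L m).
    apply: (lt_le_trans h); apply: le_pr => //.
      exact: measurable_liminf.
    move=> w /(no_jump_after_unmarked p L)[m0 _ hm].
    by exists m0 => // m /= /hm.
  move=> /(pr_liminf_ex (mN L))[k' hk'].
  have := hk' (maxn k k') (leq_maxr _ _); rewrite pr_no_mark ltNge => /negP;
    apply.
  have pm1 := pr_le1 P (measurable_marked_unit p (maxn k k')).
  apply: lerXn2r; rewrite ?nnegrE ?subr_ge0//; first exact: ltW.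
  by rewrite lerD2l lerN2 ltW// hk// leq_maxl.
apply/eqP; rewrite eq_le pr_ge0 andbT.
have : (1 - c) ^+ n @[n --> \oo] --> (0 : R).
  apply: cvg_expr; rewrite ger0_norm ?subr_ge0 ?(ltW c1)//.
  by rewrite ltrBlDr ltrDl.
move=> /(ler_cvg_to (cvg_cst _)); apply.
by near=> n; exact: bound.
Unshelve. all: by end_near. Qed.

Definition unbounded_event : set T := \bigcap_(a : nat) ~` no_jump_after a%:R.

Lemma measurable_unbounded_event : measurable unbounded_event.
Proof.
apply: bigcapT_measurable => a; apply: measurableC.
exact: measurable_no_jump_after.
Qed.

Lemma unbounded_event_jumps w : unbounded_event w ->
  unbounded_jumps X eta1 eta2 w.
Proof.
move=> h a; have nh := h (Num.truncn a).+1 I.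
have [[b [s [s1 _ bs]]]|h'] := pselect (exists b : nat,
    jump_in X eta1 eta2 (Num.truncn a).+1%:R b%:R w).
  by exists s => //; apply: lt_trans s1; exact: truncnS_gt.
by case: nh => b _ hb; apply: h'; exists b.
Qed.

Hypothesis often : 0 < pr (\bigcup_p often_marked p).

Lemma pr_unbounded_event : pr unbounded_event = 1.
Proof.
rewrite (_ : unbounded_event = ~` \bigcup_(a : nat) no_jump_after a%:R);
  last first.
  by rewrite setC_bigcup.
rewrite prC; last first.
  by apply: bigcupT_measurable => a; exact: measurable_no_jump_after.
rewrite pr_bigcup0 ?subr0// => a; first exact: measurable_no_jump_after.
exact: pr_no_jump_after.
Qed.

Notation Z := (path_rise_fall X eta1 eta2).

Let mZ : random_sequence Z. Proof. exact: measurable_path_rise_fall. Qed.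

(** The order of the limits is that of [rise_fall_cvg], so two successive
    limits inferior are taken, first in [p] and then in [m]. *)
Lemma path_rise_fall_approximable : approximable P Z.
Proof.
move=> n e e0.
pose D p m i w := rise_fall (big_step p) i (sample (incr X m) w).
have mi := measurable_incr mX.
have mb := measurable_big_step eta1 eta2.
have mD p m : random_sequence (D p m) by exact: measurable_rise_fall_sample.
pose good p m := sample (incr X m) @^-1` marked (big_step p) `\` far Z (D p m)
  n e.
have mgood p m : measurable (good p m).
  apply: measurableD; last exact: measurable_far.
  by apply: measurable_preimage;
    [exact: measurable_sample|exact: measurable_marked].
(* That c is positive yields below that marks have a positive probability. *)
pose c := 1 - Num.min e 2^-1.
have c1 : c < 1 by rewrite /c gtrBl lt_min e0 invr_gt0 ltr0Sn.
have [p hp] : exists p, c < pr (\bigcup_k \bigcap_(m in [set m | (k <=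
  m)%N]) good p m).
  pose H p := \bigcup_k \bigcap_(m in [set m | (k <= m)%N]) good p m.
  have mH p : measurable (H p) by exact: measurable_liminf.
  have : c < pr (\bigcup_k \bigcap_(p in [set p | (k <= p)%N]) H p).
    apply: (lt_le_trans c1); rewrite -pr_unbounded_event; apply: le_pr.
    - exact: measurable_unbounded_event.
    - exact: measurable_liminf.
    move=> w /unbounded_event_jumps ub.
    have [p0 hp0] := rise_fall_cvg (cX w) eta1_gt0 eta2_gt0 ub n e0.
    exists p0 => // p /= /hp0 [m0 _ hm0]; exists m0 => // m /= /hm0[h1 h2].
    split => //; move=> [i /h2]; rewrite ltNge => /negP h3 h4; exact: h3.
  by move=> /(pr_liminf_ex mH)[k /(_ k (leqnn k))]; exists k.
have [m hm] : exists m, c < pr (good p m).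
  by have [k /(_ k (leqnn k))] := pr_liminf_ex (mgood p) hp; exists k.
have mM : measurable (sample (incr X m) @^-1` marked (big_step p)).
  by apply: measurable_preimage;
    [exact: measurable_sample|exact: measurable_marked].
have c0 : 0 < c.
  have : Num.min e 2^-1 <= 2^-1 by rewrite ge_min lexx orbT.
  by rewrite /c; lra.
have mark_gt0 : 0 < pr (incr X m 0%N @^-1` big_step p).
  have : 0 < pr (\bigcup_i (incr X m i @^-1` big_step p)).
    apply: (lt_le_trans (lt_trans c0 hm)); apply: le_pr => //.
      by apply: bigcupT_measurable => i;
        exact: measurable_preimage (mi m i) (mb p).
    by move=> w [[i bi] _]; exists i.
  by move=> /pr_bigcup_gt0[|i]; [move=> i;
    exact: measurable_preimage (mi m i) (mb p)|rewrite eX].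
exists (D p m); split => //.
- exact: (rise_fall_indep (mb p) (mi m) (iX m) (eX m) mark_gt0).
- by move=> i B mB; exact: (rise_fall_law (mb p) (mi m) (iX m) (eX m) mark_gt0).
have mf : measurable (far Z (D p m) n e) by exact: measurable_far.
have : pr (far Z (D p m) n e) <= 1 - pr (good p m).
  rewrite -prC//; apply: le_pr => //; first exact: measurableC.
  by move=> w h1 [_].
have : Num.min e 2^-1 <= e by rewrite ge_min lexx.
move: hm; rewrite /c; lra.
Qed.

Lemma path_rise_fall_indep : indep_seq P Z.
Proof. exact: limit_indep path_rise_fall_approximable. Qed.

Lemma path_rise_fall_alternating : alternating_law P Z.
Proof. exact: limit_law path_rise_fall_approximable. Qed.

Lemma M0_path_rise_fall w : M_ X eta1 eta2 0 w = Z 0%N w.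
Proof. by rewrite /path_rise_fall /= /Shat /= X0 subr0. Qed.

Lemma M_path_rise_fall n w : M_ X eta1 eta2 n w - M_ X eta1 eta2 0 w =
  pair_walk (fun i => Z i.+1 w) n.
Proof.
elim: n => [|n IH]; first by rewrite subrr /pair_walk psum0.
rewrite /pair_walk /psum big_ord_recr /= -/(psum _ n) -/(pair_walk _) -IH.
rewrite /pair_sum /path_rise_fall /= odd_double /= doubleK uphalf_double; ring.
Qed.

Lemma Shat_path_rise_fall n w : Shat X eta1 eta2 n w = pair_walk (Z ^~ w) n.
Proof.
elim: n => [|n IH]; first by rewrite /pair_walk psum0 /Shat /= X0.
rewrite /pair_walk /psum big_ord_recr /= -/(psum _ n) -/(pair_walk _) -IH.
rewrite /pair_sum /path_rise_fall /= odd_double /= doubleK uphalf_double; ring.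
Qed.

End Core.

(** * Reflection *)

Section Opposite.
Context (R : realType) (d : measure_display) (T : measurableType d)
  (X : R -> T -> R) (eta1 eta2 : R).
Hypothesis cX : forall w, cadlag (X ^~ w).

Definition opp_process : R -> T -> R := fun t w => - X t w.
Notation X' := opp_process.

Lemma opp_cadlag w : cadlag (X' ^~ w).
Proof.
have [h1 h2] := cX w; split => t t0.
  by apply: cvgN; exact: h1.
by apply: is_cvgN; exact: h2.
Qed.

Lemma opp_jump t w : 0 < t -> jump X' t w = - jump X t w.
Proof.
move=> t0; have [_ /(_ t t0) h] := cX w.
rewrite /jump (_ : lim _ = - lim (X s w @[s --> t^'-]));
  first by rewrite opprB addrC opprK.
by apply: cvg_lim => //; apply: cvgN.
Qed.

Lemma opp_small (a b x : R) : small_jumps b a (- x) = small_jumps a b x.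
Proof. by rewrite /small_jumps /= lerN2 lerNl andbC. Qed.

Lemma opp_tau n : tau X' eta2 eta1 n = tau X eta1 eta2 n.
Proof.
elim: n => [//|n IH]; apply/funext => w /=; rewrite IH; congr ereal_inf.
congr (EFin @` _); apply/seteqP; split => t /= [h1 h2]; split => //;
  have t0 : 0 < t by rewrite -lte_fin (le_lt_trans (tau_ge0 X eta1 eta2 n w)
    h1).
  by move: h2; rewrite opp_jump// /setC /mkset -/(small_jumps _ _ _) opp_small.
by rewrite opp_jump// /setC /mkset -/(small_jumps _ _ _) opp_small.
Qed.

Lemma opp_Shat n w : Shat X' eta2 eta1 n w = - Shat X eta1 eta2 n w.
Proof. by rewrite /Shat opp_tau. Qed.

Lemma opp_M n w : M_ X' eta2 eta1 n w = - I_ X eta1 eta2 n w.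
Proof.
rewrite /M_ /I_ /inf opprK !opp_tau image_comp; congr sup.
Qed.

Lemma opp_incr m i : incr X' m i = fun w => - incr X m i w.
Proof. by apply/funext => w; rewrite /incr /opp_process opprB opprK addrC. Qed.

Lemma opp_big_step p x : big_step eta2 eta1 p (- x) = big_step eta1 eta2 p x.
Proof. by rewrite /big_step /setC /mkset opp_small. Qed.

Lemma opp_often_marked p : often_marked X' eta2 eta1 p =
  often_marked X eta1 eta2 p.
Proof.
apply: eq_bigcupr => k _; apply: eq_bigcapr => m _.
have e i w : big_step eta2 eta1 p (incr X' m i w) =
  big_step eta1 eta2 p (incr X m i w).
  by rewrite opp_incr opp_big_step.
by apply/seteqP; split => w [i im h]; exists i => //; rewrite ?e // -e.
Qed.

End Opposite.

(** * Levy processes *)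

Section Levy.
Context (R : realType) (d : measure_display) (T : measurableType d)
  (P : probability T R) (X : R -> T -> R).
Notation pr := (pr P).
Hypothesis levyX : levy_process P X.

Lemma levy_measurable t : 0 <= t -> measurable_fun setT (X t).
Proof. by case: levyX => h _ _ _ _; exact: h. Qed.

Lemma levy_cadlag w : cadlag (X ^~ w).
Proof. by case: levyX. Qed.

Lemma levy_incr_indep m : indep_seq P (incr X m).
Proof.
apply/mutually_independentP; first exact: measurable_incr levy_measurable _.
case: levyX => _ _ _ h _; apply: h; first exact: grid_ge0.
by move=> i; rewrite ler_grid.
Qed.

Lemma levy_incr_law m i B : measurable B ->
  pr (incr X m i @^-1` B) = pr (incr X m 0%N @^-1` B).
Proof.
case: levyX => _ _ _ _ h mB.
have e j : pr (incr X m j @^-1` B) = pr (X (mesh R m) @^-1` B).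
  have := h (grid R m j) (mesh R m) (grid_ge0 _ _ _) (ltW (mesh_gt0 _ _)) B mB.
  by rewrite -gridS /pr => <-.
by rewrite !e.
Qed.

(** Otherwise almost no path has a large jump before time 1, and the
    expected number of these jumps vanishes. *)
Lemma levy_often_marked (Pi : {measure set R -> \bar R}) (eta1 eta2 : R) :
  has_levy_measure P X Pi -> 0 < eta1 -> 0 < eta2 ->
  (0 < Pi (~` small_jumps eta1 eta2))%E ->
  0 < pr (\bigcup_p often_marked X eta1 eta2 p).
Proof.
move=> levyPi e1 e2.
have msj : measurable (small_jumps eta1 eta2).
  rewrite (_ : small_jumps _ _ = `[- eta1, eta2]%classic).
    exact: measurable_itv.
  by apply/seteqP; split => x; rewrite /small_jumps /= in_itv.
rewrite levyPi; last exact: measurableC.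
apply: contraPP => /negP; rewrite -leNgt => prG.
set G := \bigcup_p _ in prG.
have mG : measurable G.
  apply: bigcupT_measurable => p.
  by apply: measurable_often_marked; exact: levy_measurable.
have PG : P G = 0%E.
  by rewrite prE//; congr EFin; apply/eqP; rewrite eq_le prG pr_ge0.
apply/negP; rewrite -leNgt.
apply: (@le_trans _ _ (\int[P]_w ((cst +oo%E) \_ G) w)%E).
  apply: ge0_le_integral_total => w; first exact: measure_ge0.
  rewrite patchE; case: ifPn => [_|/negP]; first by rewrite leey.
  rewrite inE => nG.
  rewrite (_ : unit_jump_times _ _ _ = set0) ?measure0//.
  apply/seteqP; split => // t [/= t0 t1 _ jt]; apply: nG.
  exact: (unit_jump_often_marked levy_cadlag t1).
have PG' : (+oo * P G = 0)%E by rewrite PG mule0.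
by rewrite -integral_mkcond integral_cst// [X in (X <= _)%E]PG'.
Qed.

End Levy.

Theorem theorem1p1 (R : realType) (d : measure_display) (T : measurableType d)
    (P : probability T R) (X : R -> T -> R) (Pi : {measure set R -> \bar R})
    (eta1 eta2 : R)
    (levyX : levy_process P X) (levyPi : has_levy_measure P X Pi)
    (eta1_gt0 : 0 < eta1) (eta2_gt0 : 0 < eta2)
    (Delta_gt0 : (0 < Pi (~` small_jumps eta1 eta2))%E) :
  [/\ forall n w, M_ X eta1 eta2 n w =
                    Splus X eta1 eta2 n w + m0 X eta1 eta2 w /\
                  I_ X eta1 eta2 n w =
                    Sminus X eta1 eta2 n w + i0 X eta1 eta2 w,
      random_walk P (Splus X eta1 eta2) /\
      same_distribution P (Splus X eta1 eta2) (Shat X eta1 eta2),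
      random_walk P (Sminus X eta1 eta2) /\
      same_distribution P (Sminus X eta1 eta2) (Shat X eta1 eta2),
      independent_of P (Splus X eta1 eta2) (m0 X eta1 eta2) &
      independent_of P (Sminus X eta1 eta2) (i0 X eta1 eta2)].
Proof.
have mX := levy_measurable levyX.
have cX := levy_cadlag levyX.
have X0 w : X 0 w = 0 by case: levyX.
have iX := levy_incr_indep levyX.
have eX := levy_incr_law levyX.
have oX := levy_often_marked levyX levyPi eta1_gt0 eta2_gt0 Delta_gt0.
pose Z := path_rise_fall X eta1 eta2.
have mZ : random_sequence Z by exact: measurable_path_rise_fall.
have iZ : indep_seq P Z by exact: path_rise_fall_indep.
have aZ : alternating_law P Z by exact: path_rise_fall_alternating.
have SE n w : Splus X eta1 eta2 n w = pair_walk (fun i => Z i.+1 w) n.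
  by rewrite /Splus m0_M0 M_path_rise_fall.
have S'E n w : Shat X eta1 eta2 n w =
  pair_walk (Z ^~ w) n by exact: Shat_path_rise_fall.
have YE w : m0 X eta1 eta2 w = Z 0%N w by rewrite m0_M0 M0_path_rise_fall.
pose X' := opp_process X.
have mX' t : 0 <= t -> measurable_fun setT (X' t).
  by move=> t0; apply: measurable_funN; exact: mX.
have cX' : forall w, cadlag (X' ^~ w) by exact: opp_cadlag.
have X0' w : X' 0 w = 0 by rewrite /X' /opp_process X0 oppr0.
have iX' m : indep_seq P (incr X' m).
  rewrite (_ : incr X' m = fun i w => - incr X m i w); first exact: indep_opp.
  by apply/funext => i; rewrite opp_incr.
have eX' m i B : measurable B ->
    pr P (incr X' m i @^-1` B) = pr P (incr X' m 0%N @^-1` B).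
  move=> mB; rewrite !opp_incr; apply: (eX m i (-%R @^-1` B)).
  by apply: measurable_preimage => //; exact: oppr_measurable.
have oX' : 0 < pr P (\bigcup_p often_marked X' eta2 eta1 p).
  by rewrite (eq_bigcupr (fun p _ => opp_often_marked X eta1 eta2 p)).
pose Z' i w := - path_rise_fall X' eta2 eta1 i w.
have mZ'' : random_sequence (path_rise_fall X' eta2 eta1) by exact:
  measurable_path_rise_fall.
have mZ' : random_sequence Z' by move=> i; exact: measurable_funN.
have iZ' : indep_seq P Z' by apply: indep_opp; exact: path_rise_fall_indep.
have aZ' : alternating_law P Z'.
  have aZ'' : alternating_law P (path_rise_fall X' eta2 eta1) by exact:
    path_rise_fall_alternating.
  move=> i B mB; apply: (aZ'' i (-%R @^-1` B)).
  by apply: measurable_preimage => //; exact: oppr_measurable.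
have IE n w : I_ X eta1 eta2 n w = - M_ X' eta2 eta1 n w.
  by rewrite opp_M// opprK.
have SE' n w : Sminus X eta1 eta2 n w = pair_walk (fun i => Z' i.+1 w) n.
  by rewrite /Sminus i0_I0 !IE -opprD M_path_rise_fall// pair_walk_opp.
have S'E' n w : Shat X eta1 eta2 n w = pair_walk (Z' ^~ w) n.
  by rewrite pair_walk_opp -Shat_path_rise_fall// opp_Shat// opprK.
have YE' w : i0 X eta1 eta2 w = Z' 0%N w by rewrite i0_I0 IE M0_path_rise_fall.
split.
- by move=> n w; rewrite /Splus /Sminus !subrK.
- split; first exact: alternating_random_walk SE.
  exact: alternating_same_distribution SE S'E.
- split; first exact: alternating_random_walk SE'.
  exact: alternating_same_distribution SE' S'E'.
- exact: alternating_independent_of SE YE.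
- exact: alternating_independent_of SE' YE'.
Qed.
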